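(* Let $p$ be a prime and let $\mathbb Z_p$ denote the ring of $p$-adic integers, considered as a module over itself. Then $K_0(\mathbb Z_p)\cong\mathbb Z[X]/\langle(p-1)X\rangle$ as rings.
   Context: For a ring $\mathcal R$, a right $\mathcal R$-module $M$ is viewed as a first order structure in the language $\langle 0,+,-,m_r: r\in\mathcal R\rangle$, where $m_r$ is interpreted as right multiplication by $r$ (here $\mathcal R=M=\mathbb Z_p$). ''Definable'' means definable with parameters from $M$. Two definable sets $A\subseteq M^n$, $B\subseteq M^m$ ($n,m\ge1$) are definably isomorphic if there is a bijection $A\to B$ with definable graph; $[A]$ denotes the equivalence class. The set $\widetilde{\mathrm{Def}}(M)$ of all classes is a commutative semiring with $0=[\emptyset]$, $1=[\text{singleton}]$, $[A]+[B]=[A'\sqcup B']$ for disjoint $A'\in[A]$, $B'\in[B]$, and $[A]\cdot[B]=[A\times B]$. $K_0(M)$ is the Grothendieck ring of this semiring, i.e. the ring with the universal semiring homomorphism from $\widetilde{\mathrm{Def}}(M)$ to a commutative ring. *)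

(* Defs.v *)
From HB Require Import structures.
From mathcomp Require Import all_boot all_order all_algebra ring.
From mathcomp Require Import boolp classical_sets functions.

Set Implicit Arguments.
Unset Strict Implicit.
Unset Printing Implicit Defensive.

Import GRing.Theory.

Local Open Scope classical_set_scope.
Local Open Scope ring_scope.
Local Open Scope quotient_scope.

(* First-order formulas in the language <0, +, -, m_r : r in R> of right
   R-modules, with parameters from M.  A right R-module is a left module over
   the opposite ring R^c, so that [r *: x] is the right multiplication of x by
   r.  Variables are de Bruijn indices: a quantifier binds variable 0 and
   shifts the others. *)

Inductive term (R M : Type) : Type :=
| Var of nat
| Param of M
| Zero
| Add of term R M & term R M
| Opp of term R M
| Act of term R M & R.

Inductive formula (R M : Type) : Type :=
| Bot
| Equal of term R M & term R M
| Neg of formula R M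
| Conj of formula R M & formula R M
| Disj of formula R M & formula R M
| Impl of formula R M & formula R M
| All of formula R M
| Ex of formula R M.

Arguments Var {R M}.
Arguments Param {R M}.
Arguments Zero {R M}.
Arguments Bot {R M}.

Definition scons (T : Type) (x : T) (e : nat -> T) : nat -> T :=
  fun i => if i is j.+1 then e j else x.

Section Semantics.
Variables (R : pzRingType) (M : lmodType R^c).

Fixpoint eval (e : nat -> M) (t : term R M) : M :=
  match t with
  | Var i => e i
  | Param c => c
  | Zero => 0
  | Add t u => eval e t + eval e u
  | Opp t => - eval e t
  | Act t r => (r : R^c) *: eval e t
  end.

Fixpoint holds (e : nat -> M) (f : formula R M) : Prop :=
  match f with
  | Bot => False
  | Equal t u => eval e t = eval e u
  | Neg f => ~ holds e f
  | Conj f g => holds e f /\ holds e g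
  | Disj f g => holds e f \/ holds e g
  | Impl f g => holds e f -> holds e g
  | All f => forall x, holds (scons x e) f
  | Ex f => exists x, holds (scons x e) f
  end.

(* Variables beyond the length of v are read as the constant 0 of the
   language. *)
Definition env n (v : 'rV[M]_n) : nat -> M :=
  fun i => if insub i is Some j then v 0 (j : 'I_n) else 0.

Definition definable n (A : set 'rV[M]_n) : Prop :=
  exists f : formula R M, forall v, A v <-> holds (env v) f.

Definition graph n m (A : set 'rV[M]_n) (f : 'rV[M]_n -> 'rV[M]_m) :
    set 'rV[M]_(n + m) :=
  [set row_mx v (f v) | v in A].

Definition definably_isomorphic n m (A : set 'rV[M]_n) (B : set 'rV[M]_m) :
    Prop :=
  exists f : 'rV[M]_n -> 'rV[M]_m, set_bij A B f /\ definable (graph A f).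

End Semantics.

Section Substitution.
Variables (R : pzRingType) (M : lmodType R^c).
Implicit Types (s : nat -> term R M) (t : term R M) (e : nat -> M).

Fixpoint tsubst s t : term R M :=
  match t with
  | Var i => s i
  | Param c => Param c
  | Zero => Zero
  | Add t u => Add (tsubst s t) (tsubst s u)
  | Opp t => Opp (tsubst s t)
  | Act t r => Act (tsubst s t) r
  end.

Definition lift_subst s : nat -> term R M :=
  scons (Var 0) (fun i => tsubst (fun j => Var j.+1) (s i)).

Fixpoint fsubst s (f : formula R M) : formula R M :=
  match f with
  | Bot => Bot
  | Equal t u => Equal (tsubst s t) (tsubst s u)
  | Neg f => Neg (fsubst s f)
  | Conj f g => Conj (fsubst s f) (fsubst s g)
  | Disj f g => Disj (fsubst s f) (fsubst s g)
  | Impl f g => Impl (fsubst s f) (fsubst s g)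
  | All f => All (fsubst (lift_subst s) f)
  | Ex f => Ex (fsubst (lift_subst s) f)
  end.

Lemma eval_tsubst e s t : eval e (tsubst s t) = eval (fun i => eval e (s i)) t.
Proof. by elim: t => //= [t -> u -> | t -> | t -> r]. Qed.

Lemma eval_lift e s x :
  (fun i => eval (scons x e) (lift_subst s i)) =
  scons x (fun i => eval e (s i)).
Proof. by apply/funext => -[|i] //=; rewrite eval_tsubst. Qed.

Lemma holds_fsubst e s f :
  holds e (fsubst s f) <-> holds (fun i => eval e (s i)) f.
Proof.
elim: f e s => //= [t u|f IH|f IHf g IHg|f IHf g IHg|f IHf g IHg|f IH|f IH] e s.
- by rewrite !eval_tsubst.
- by rewrite IH.
- by rewrite IHf IHg.
- by rewrite IHf IHg.
- by rewrite IHf IHg.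
- by split=> H x; have := H x; rewrite IH eval_lift.
- by split=> -[x H]; exists x; move: H; rewrite IH eval_lift.
Qed.

Lemma env_ord n (v : 'rV[M]_n) (i : 'I_n) : env v i = v 0 i.
Proof. by rewrite /env valK. Qed.

Lemma env_ge n (v : 'rV[M]_n) i : (n <= i)%N -> env v i = 0.
Proof. by move=> h; rewrite /env insubF // ltnNge h. Qed.

(* Affine maps, i.e. tuples of terms. *)
Definition tmap n m (f : 'rV[M]_n -> 'rV[M]_m) : Prop :=
  exists s : 'I_m -> term R M, forall v j, f v 0 j = eval (env v) (s j).

Lemma tmap_id n : tmap (fun v : 'rV[M]_n => v).
Proof. by exists (fun j => Var j) => v j /=; rewrite env_ord. Qed.

Lemma tmap_cst n m (c : 'rV[M]_m) : tmap (fun _ : 'rV[M]_n => c).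
Proof. by exists (fun j => Param (c 0 j)). Qed.

Lemma tmapD n m (f g : 'rV[M]_n -> 'rV[M]_m) :
  tmap f -> tmap g -> tmap (fun v => f v + g v).
Proof.
move=> [s hs] [t ht]; exists (fun j => Add (s j) (t j)) => v j /=.
by rewrite mxE hs ht.
Qed.

Lemma tmapN n m (f : 'rV[M]_n -> 'rV[M]_m) : tmap f -> tmap (fun v => - f v).
Proof. by move=> [s hs]; exists (fun j => Opp (s j)) => v j /=; rewrite mxE hs. Qed.

Lemma tmap_row n m k (f : 'rV[M]_n -> 'rV[M]_m) (g : 'rV[M]_n -> 'rV[M]_k) :
  tmap f -> tmap g -> tmap (fun v => row_mx (f v) (g v)).
Proof.
move=> [s hs] [t ht].
exists (fun j => match fintype.split j with inl i => s i | inr i => t i end) => v j.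
by rewrite mxE; case: splitP => i _.
Qed.

Lemma tmap_l n m k (f : 'rV[M]_n -> 'rV[M]_(m + k)) :
  tmap f -> tmap (fun v => lsubmx (f v)).
Proof. by move=> [s hs]; exists (fun j => s (lshift k j)) => v j; rewrite mxE. Qed.

Lemma tmap_r n m k (f : 'rV[M]_n -> 'rV[M]_(m + k)) :
  tmap f -> tmap (fun v => rsubmx (f v)).
Proof. by move=> [s hs]; exists (fun j => s (rshift m j)) => v j; rewrite mxE. Qed.

Lemma definable_ext n (A B : set 'rV[M]_n) :
  (forall v, A v <-> B v) -> definable A -> definable B.
Proof. by move=> h [f hf]; exists f => v; rewrite -h. Qed.

Lemma dsub n m (A : set 'rV[M]_m) (f : 'rV[M]_n -> 'rV[M]_m) :
  definable A -> tmap f -> definable (fun v => A (f v)).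
Proof.
move=> [phi h] [s hs].
exists (fsubst (fun i => if insub i is Some j then s j else Zero) phi) => v.
rewrite h holds_fsubst; set e := (fun i => eval _ _).
suff -> : env (f v) = e by [].
by apply/funext => i; rewrite /env /e; case: insubP => //= j _ _; rewrite hs.
Qed.

Lemma dand n (A B : set 'rV[M]_n) :
  definable A -> definable B -> definable (fun v => A v /\ B v).
Proof. by move=> [f hf] [g hg]; exists (Conj f g) => v /=; rewrite hf hg. Qed.

Lemma dor n (A B : set 'rV[M]_n) :
  definable A -> definable B -> definable (fun v => A v \/ B v).
Proof. by move=> [f hf] [g hg]; exists (Disj f g) => v /=; rewrite hf hg. Qed.

Lemma dcst n (P : Prop) : definable (fun _ : 'rV[M]_n => P).
Proof.
case: (pselect P) => h; first by exists (Neg Bot) => v /=; tauto.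
by exists Bot => v /=; tauto.
Qed.

Lemma deq n m (f g : 'rV[M]_n -> 'rV[M]_m) :
  tmap f -> tmap g -> definable (fun v => f v = g v).
Proof.
move=> [s hs] [t ht].
exists (foldr (fun i => Conj (Equal (s i) (t i))) (Neg Bot) (enum 'I_m)) => v.
have -> : (f v = g v) <-> forall i, i \in enum 'I_m -> f v 0 i = g v 0 i.
  split=> [-> //|h]; apply/rowP => i; apply: h; exact: mem_enum.
elim: (enum 'I_m) => [|i r IH] /=; first by split=> // _ [].
rewrite -IH -hs -ht; split=> [h|[h1 h2] j].
  split=> [|j jr]; apply: h; rewrite inE ?eqxx // jr orbT //.
by rewrite inE => /predU1P[-> //|/h2].
Qed.

Lemma dex1 n (P : 'rV[M]_n -> 'rV[M]_1 -> Prop) :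
  definable (fun v : 'rV[M]_(n + 1) => P (lsubmx v) (rsubmx v)) ->
  definable (fun v => exists w, P v w).
Proof.
move=> [f h].
exists (Ex (fsubst (fun i => if (i < n)%N then Var i.+1 else
                     if i == n then Var 0 else Zero) f)) => v /=.
have E x :
  P v (const_mx x) <-> holds (env (row_mx v (const_mx x : 'rV_1))) f.
  by have := h (row_mx v (const_mx x)); rewrite row_mxKl row_mxKr.
have K x : env (row_mx v (const_mx x : 'rV_1)) =
    (fun i => eval (scons x (env v)) (if (i < n)%N then Var i.+1 else
                     if i == n then Var 0 else Zero)).
  apply/funext => i; have [hi|hi|->] := ltngtP i n => /=.
  - rewrite -[i]/(nat_of_ord (lshift 1 (Ordinal hi))) env_ord row_mxEl.
    by rewrite -[i in RHS]/(nat_of_ord (Ordinal hi)) env_ord.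
  - by rewrite env_ge // addn1.
  - rewrite -[X in env _ X]addn0 -[(n + 0)%N]/(nat_of_ord (rshift n (0 : 'I_1))).
    by rewrite env_ord row_mxEr mxE.
split=> [[w Pw]|[x hx]].
  exists (w 0 0); rewrite holds_fsubst -K -E.
  by rewrite (_ : const_mx _ = w) //; apply/rowP => j; rewrite mxE (ord1 j).
by exists (const_mx x); rewrite E K -holds_fsubst.
Qed.

Lemma dex n m (P : 'rV[M]_n -> 'rV[M]_m -> Prop) :
  definable (fun v : 'rV[M]_(n + m) => P (lsubmx v) (rsubmx v)) ->
  definable (fun v => exists w, P v w).
Proof.
elim: m n P => [|m IH] n P hP.
  have hP' : definable (fun v : 'rV[M]_n => P v 0).
    apply: definable_ext (dsub hP (tmap_row (@tmap_id n) (tmap_cst n 0))) => v.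
    by rewrite row_mxKl row_mxKr.
  apply: definable_ext hP' => v; split=> [h|[w]]; first by exists 0.
  by rewrite (_ : w = 0) //; apply/rowP => -[].
pose Q (v : 'rV[M]_n) (x : 'rV[M]_1) := exists w : 'rV[M]_m, P v (row_mx x w).
suff dQ : definable (fun v => exists x, Q v x).
  apply: definable_ext dQ => v; split=> [[x [w h]]|[w h]].
    by exists (row_mx x w).
  by exists (@lsubmx M 1 1 m w), (@rsubmx M 1 1 m w); rewrite hsubmxK.
apply: dex1; rewrite /Q.
pose S (u : 'rV[M]_(n + 1)) (w : 'rV[M]_m) : Prop :=
  P (lsubmx u) (row_mx (rsubmx u : 'rV[M]_1) w).
apply: (IH _ S); rewrite /S.
have t : tmap (fun v : 'rV[M]_((n + 1) + m) =>
   row_mx (lsubmx (lsubmx v)) (row_mx (rsubmx (lsubmx v)) (rsubmx v)) :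
     'rV_(n + m.+1)).
  have ti := @tmap_id (n + 1 + m).
  apply: tmap_row; first exact: tmap_l (tmap_l ti).
  exact: tmap_row (tmap_r (tmap_l ti)) (tmap_r ti).
by apply: definable_ext (dsub hP t) => v; rewrite row_mxKl row_mxKr.
Qed.

End Substitution.

Section DefinableBijections.
Variables (R : pzRingType) (M : lmodType R^c).

Variant bij_rel n m (A : set 'rV[M]_n) (B : set 'rV[M]_m)
    (G : 'rV[M]_n -> 'rV[M]_m -> Prop) : Prop :=
  BijRel of definable (fun v : 'rV[M]_(n + m) => G (lsubmx v) (rsubmx v))
  & (forall u v, G u v -> A u /\ B v)
  & (forall u, A u -> exists v, G u v)
  & (forall v, B v -> exists u, G u v)
  & (forall u v v', G u v -> G u v' -> v = v')
  & (forall u u' v, G u v -> G u' v -> u = u').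

Lemma rel_iso n m (A : set 'rV[M]_n) (B : set 'rV[M]_m) G :
  bij_rel A B G -> definably_isomorphic A B.
Proof.
move=> [dG GAB GA GB Gfun Ginj]; pose f u := xget 0 (G u).
have Gf u : A u -> G u (f u) by move=> /GA Gu; exact: xgetPex.
exists f; split; first split.
- by move=> u /Gf /GAB[].
- by move=> u u' /set_mem/Gf h /set_mem/Gf h' e; apply: Ginj h _; rewrite e.
- move=> v /GB[u h]; have [Au _] := GAB _ _ h.
  by exists u => //; apply: Gfun h; exact: Gf.
apply: definable_ext dG => w; split=> [h|[u Au <-]].
  have [Au _] := GAB _ _ h; exists (lsubmx w) => //.
  by rewrite -(Gfun _ _ _ h (Gf _ Au)) hsubmxK.
by rewrite row_mxKl row_mxKr; exact: Gf.
Qed.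

Lemma iso_rel n m (A : set 'rV[M]_n) (B : set 'rV[M]_m) :
  definably_isomorphic A B -> exists G, bij_rel A B G.
Proof.
move=> [f [[fAB finj fsurj] df]]; exists (fun u v => A u /\ v = f u); split.
- apply: definable_ext df => w; split=> [[u Au <-]|[Au e]].
    by rewrite row_mxKl row_mxKr.
  by exists (lsubmx w) => //; rewrite -e hsubmxK.
- by move=> u v [Au ->]; split=> //; exact: fAB.
- by move=> u Au; exists (f u).
- by move=> v /fsurj[u Au <-]; exists u.
- by move=> u v v' [_ ->] [_ ->].
- by move=> u u' v [Au ->] [Au' /finj]; apply; exact: mem_set.
Qed.

Lemma tmap_iso n m (A : set 'rV[M]_n) (B : set 'rV[M]_m)
    (f : 'rV[M]_n -> 'rV[M]_m) (g : 'rV[M]_m -> 'rV[M]_n) :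
  definable A -> tmap f ->
  (forall u, A u -> B (f u) /\ g (f u) = u) ->
  (forall v, B v -> A (g v) /\ f (g v) = v) -> definably_isomorphic A B.
Proof.
move=> dA tf fP gP; apply: (@rel_iso _ _ _ _ (fun u v => A u /\ v = f u)).
have ti := @tmap_id _ M (n + m); split.
- apply: dand; first exact: dsub dA (tmap_l ti).
  apply: deq; first exact: tmap_r ti.
  case: tf => s hs.
  pose s' j := tsubst (fun i => if insub i is Some k then
                                  Var (nat_of_ord (lshift m (k : 'I_n)))
                                else Zero) (s j).
  exists s' => w j; rewrite hs eval_tsubst; congr eval; apply/funext => i.
  rewrite {1}/env; case: insubP => // k _ _.
  by rewrite /eval env_ord mxE.
- by move=> u v [Au ->]; have [] := fP _ Au.
- by move=> u Au; exists (f u).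
- by move=> v /gP[Ag e]; exists (g v).
- by move=> u v v' [_ ->] [_ ->].
- move=> u u' v [Au ->] [Au' e].
  by have [_ <-] := fP _ Au; have [_ <-] := fP _ Au'; rewrite e.
Qed.

Lemma iso_refl n (A : set 'rV[M]_n) : definable A -> definably_isomorphic A A.
Proof. by move=> dA; apply: (tmap_iso (f := id) (g := id)) => //; exact: tmap_id. Qed.

Lemma iso_sym n m (A : set 'rV[M]_n) (B : set 'rV[M]_m) :
  definably_isomorphic A B -> definably_isomorphic B A.
Proof.
move=> /iso_rel[G [dG GAB GA GB Gfun Ginj]].
apply: (@rel_iso _ _ _ _ (fun v u => G u v)); split=> //.
- have ti := @tmap_id _ M (m + n).
  apply: definable_ext (dsub dG (tmap_row (tmap_r ti) (tmap_l ti))) => w.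
  by rewrite row_mxKl row_mxKr.
- by move=> v u /GAB[].
- by move=> v u u'; exact: Ginj.
- by move=> v v' u; exact: Gfun.
Qed.

Lemma iso_trans n m k (A : set 'rV[M]_n) (B : set 'rV[M]_m) (C : set 'rV[M]_k) :
  definably_isomorphic A B -> definably_isomorphic B C ->
  definably_isomorphic A C.
Proof.
move=> /iso_rel[G [dG GAB GA GB Gfun Ginj]] /iso_rel[H [dH HBC HB HC Hfun Hinj]].
apply: (@rel_iso _ _ _ _ (fun u w => exists v, G u v /\ H v w)); split.
- pose P (x : 'rV[M]_(n + k)) (v : 'rV[M]_m) :=
    G (lsubmx x) v /\ H v (rsubmx x).
  apply: (dex (P := P)); have ti := @tmap_id _ M (n + k + m); apply: dand.
    apply: definable_ext (dsub dG (tmap_row (tmap_l (tmap_l ti)) (tmap_r ti))).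
    by move=> w; rewrite row_mxKl row_mxKr.
  apply: definable_ext (dsub dH (tmap_row (tmap_r ti) (tmap_r (tmap_l ti)))).
  by move=> w; rewrite row_mxKl row_mxKr.
- by move=> u w [v [/GAB[Au _] /HBC[_ Cw]]].
- move=> u /GA[v h]; have [_ /HB[w h']] := GAB _ _ h.
  by exists w, v.
- move=> w /HC[v h]; have [/GB[u h'] _] := HBC _ _ h.
  by exists u, v.
- move=> u w w' [v [Guv Hvw]] [v' [Guv' Hvw']].
  by move: Hvw'; rewrite -(Gfun _ _ _ Guv Guv') => /(Hfun _ _ _ Hvw).
- move=> u u' w [v [Guv Hvw]] [v' [Guv' Hvw']].
  by move: Guv'; rewrite -(Hinj _ _ _ Hvw Hvw') => /(Ginj _ _ _ Guv).
Qed.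

End DefinableBijections.

Record defset (R : pzRingType) (M : lmodType R^c) := DefSet {
  dim : nat;
  points :> set 'rV[M]_dim;
  dim_gt0 : (0 < dim)%N;
  points_definable : definable points
}.

Arguments points {R M} d : rename.
Arguments points_definable {R M} d : rename.

HB.instance Definition _ (R : pzRingType) (M : lmodType R^c) :=
  gen_eqMixin (defset M).
HB.instance Definition _ (R : pzRingType) (M : lmodType R^c) :=
  gen_choiceMixin (defset M).

Section DefinableClasses.
Variables (R : pzRingType) (M : lmodType R^c).
Implicit Types A B : defset M.

Definition iso A B : bool := `[< definably_isomorphic A B >].

Lemma iso_equiv : equiv_class_of iso.
Proof.
split=> [A|A B|B A C].
- by apply/asboolP/iso_refl; exact: points_definable.
- by apply/asboolP/asboolP => /iso_sym.
- by move=> /asboolP h /asboolP h'; apply/asboolP; exact: iso_trans h h'.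
Qed.

Canonical iso_equiv_rel := EquivRelPack iso_equiv.

Definition defclass := {eq_quot iso}.
HB.instance Definition _ := Choice.on defclass.
HB.instance Definition _ := EqQuotient.on defclass.

Definition class A : defclass := \pi_defclass A.

Lemma classP A B : class A = class B <-> definably_isomorphic A B.
Proof. 
split=> [/eqmodP/asboolP //|h]; apply/eqmodP; exact/asboolP.
Qed.

End DefinableClasses.

(* The ring R as a right module over itself: [r *: x] is [x * r] in R. *)
Definition right_regular (R : pzRingType) : lmodType R^c := (R^c)^o.

Section DefinableSemiring.
Variable R : nzRingType.
Let M : lmodType R^c := right_regular R.
Implicit Types A B C : defset M.

Let ti n := @tmap_id _ M n.

Let tag1 : 'rV[M]_1 := const_mx (1 : R).

Let tag1_neq0 : tag1 <> 0.
Proof. by move/rowP/(_ 0)/eqP; rewrite !mxE oner_eq0. Qed.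

Definition emptyset : set 'rV[M]_1 := set0.
Definition origin : set 'rV[M]_1 := [set 0].

Definition setprod n m (A : set 'rV[M]_n) (B : set 'rV[M]_m) :
    set 'rV[M]_(n + m) :=
  [set w | A (lsubmx w) /\ B (rsubmx w)].

(* The disjoint copies A x {0} x {0} and {0} x B x {1}. *)
Definition setsum n m (A : set 'rV[M]_n) (B : set 'rV[M]_m) :
    set 'rV[M]_(n + m + 1) :=
  [set row_mx (row_mx a 0) 0 | a in A] `|`
  [set row_mx (row_mx 0 b) (const_mx (1 : R)) | b in B].

Lemma emptyset_definable : definable emptyset.
Proof. exact: dcst. Qed.

Lemma origin_definable : definable origin.
Proof. exact: deq (@ti 1) (tmap_cst 1 0). Qed.

Lemma setprod_definable n m (A : set 'rV[M]_n) (B : set 'rV[M]_m) :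
  definable A -> definable B -> definable (setprod A B).
Proof.
by move=> dA dB; apply: dand; [exact: dsub dA (tmap_l (@ti _))
                              |exact: dsub dB (tmap_r (@ti _))].
Qed.

Lemma setsumP n m (A : set 'rV[M]_n) (B : set 'rV[M]_m) w :
  setsum A B w <->
  (A (lsubmx (lsubmx w)) /\ w = row_mx (row_mx (lsubmx (lsubmx w)) 0) 0) \/
  (B (rsubmx (lsubmx w)) /\ w = row_mx (row_mx 0 (rsubmx (lsubmx w))) tag1).
Proof.
split=> [[[a Aa <-]|[b Bb <-]]|[[Aa ->]|[Bb ->]]].
- by left; rewrite !row_mxKl.
- by right; rewrite row_mxKl row_mxKr.
- by left; exists (lsubmx (lsubmx w)).
- by right; exists (rsubmx (lsubmx w)).
Qed.

Lemma setsum_definable n m (A : set 'rV[M]_n) (B : set 'rV[M]_m) :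
  definable A -> definable B -> definable (setsum A B).
Proof.
move=> dA dB; apply: definable_ext (fun w => iff_sym (setsumP A B w)) _.
have t := @ti (n + m + 1); have tl := tmap_l (tmap_l t).
have tr := tmap_r (tmap_l t).
apply: dor; apply: dand.
- exact: dsub dA tl.
- exact: deq t (tmap_row (tmap_row tl (tmap_cst _ _)) (tmap_cst _ _)).
- exact: dsub dB tr.
- exact: deq t (tmap_row (tmap_row (tmap_cst _ _) tr) (tmap_cst _ _)).
Qed.

Definition defset0 : defset M := DefSet (ltn0Sn 0) emptyset_definable.
Definition defset1 : defset M := DefSet (ltn0Sn 0) origin_definable.
Definition defsetM A B : defset M :=
  DefSet (ltn_addr (dim B) (dim_gt0 A))
         (setprod_definable (points_definable A) (points_definable B)).
Definition defsetD A B : defset M :=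
  DefSet (ltn_addr 1 (ltn_addr (dim B) (dim_gt0 A)))
         (setsum_definable (points_definable A) (points_definable B)).

Lemma setprod_iso n m n' m' (A : set 'rV[M]_n) (B : set 'rV[M]_m)
    (A' : set 'rV[M]_n') (B' : set 'rV[M]_m') :
  definably_isomorphic A A' -> definably_isomorphic B B' ->
  definably_isomorphic (setprod A B) (setprod A' B').
Proof.
move=> /iso_rel[G [dG GAB GA GB Gfun Ginj]] /iso_rel[H [dH HAB HA HB Hfun Hinj]].
apply: (@rel_iso _ _ _ _ _ _
  (fun u v => G (lsubmx u) (lsubmx v) /\ H (rsubmx u) (rsubmx v))); split.
- have t := @ti ((n + m) + (n' + m')); apply: dand.
    apply: definable_ext
      (dsub dG (tmap_row (tmap_l (tmap_l t)) (tmap_l (tmap_r t)))) => w.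
    by rewrite row_mxKl row_mxKr.
  apply: definable_ext
      (dsub dH (tmap_row (tmap_r (tmap_l t)) (tmap_r (tmap_r t)))) => w.
  by rewrite row_mxKl row_mxKr.
- by move=> u v [/GAB[? ?] /HAB[? ?]].
- move=> u [/GA[v h] /HA[w h']]; exists (row_mx v w).
  by rewrite row_mxKl row_mxKr.
- move=> u [/GB[v h] /HB[w h']]; exists (row_mx v w).
  by rewrite row_mxKl row_mxKr.
- move=> u v v' [g h] [g' h'].
  by rewrite -[v]hsubmxK -[v']hsubmxK (Gfun _ _ _ g g') (Hfun _ _ _ h h').
- move=> u u' v [g h] [g' h'].
  by rewrite -[u]hsubmxK -[u']hsubmxK (Ginj _ _ _ g g') (Hinj _ _ _ h h').
Qed.

Lemma setsum_iso n m n' m' (A : set 'rV[M]_n) (B : set 'rV[M]_m)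
    (A' : set 'rV[M]_n') (B' : set 'rV[M]_m') :
  definably_isomorphic A A' -> definably_isomorphic B B' ->
  definably_isomorphic (setsum A B) (setsum A' B').
Proof.
move=> /iso_rel[G [dG GAB GA GB Gfun Ginj]] /iso_rel[H [dH HAB HA HB Hfun Hinj]].
apply: (@rel_iso _ _ _ _ _ _ (fun u v =>
  ((u = row_mx (row_mx (lsubmx (lsubmx u)) 0) 0 /\
    v = row_mx (row_mx (lsubmx (lsubmx v)) 0) 0) /\
   G (lsubmx (lsubmx u)) (lsubmx (lsubmx v))) \/
  ((u = row_mx (row_mx 0 (rsubmx (lsubmx u))) tag1 /\
    v = row_mx (row_mx 0 (rsubmx (lsubmx v))) tag1) /\
   H (rsubmx (lsubmx u)) (rsubmx (lsubmx v))))); split.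
- have t := @ti ((n + m + 1) + (n' + m' + 1)).
  have tu := tmap_l t; have tv := tmap_r t.
  apply: dor; apply: dand; first apply: dand.
  + exact: deq tu (tmap_row (tmap_row (tmap_l (tmap_l tu)) (tmap_cst _ _))
                            (tmap_cst _ _)).
  + exact: deq tv (tmap_row (tmap_row (tmap_l (tmap_l tv)) (tmap_cst _ _))
                            (tmap_cst _ _)).
  + apply: definable_ext (dsub dG (tmap_row (tmap_l (tmap_l tu))
                                            (tmap_l (tmap_l tv)))) => w.
    by rewrite row_mxKl row_mxKr.
  + apply: dand.
      exact: deq tu (tmap_row (tmap_row (tmap_cst _ _) (tmap_r (tmap_l tu)))
                              (tmap_cst _ _)).
    exact: deq tv (tmap_row (tmap_row (tmap_cst _ _) (tmap_r (tmap_l tv)))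
                            (tmap_cst _ _)).
  + apply: definable_ext (dsub dH (tmap_row (tmap_r (tmap_l tu))
                                            (tmap_r (tmap_l tv)))) => w.
    by rewrite row_mxKl row_mxKr.
- move=> u v [[[eu ev] /GAB[? ?]]|[[eu ev] /HAB[? ?]]]; rewrite !setsumP.
    by split; left.
  by split; right.
- move=> u /setsumP[[/GA[v h] e]|[/HA[v h] e]].
    by exists (row_mx (row_mx v 0) 0); left; rewrite !row_mxKl.
  by exists (row_mx (row_mx 0 v) tag1); right; rewrite row_mxKl row_mxKr.
- move=> u /setsumP[[/GB[v h] e]|[/HB[v h] e]].
    by exists (row_mx (row_mx v 0) 0); left; rewrite !row_mxKl.
  by exists (row_mx (row_mx 0 v) tag1); right; rewrite row_mxKl row_mxKr.
- move=> u v v' [[[eu ev] h]|[[eu ev] h]] [[[eu' ev'] h']|[[eu' ev'] h']].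
  + by rewrite ev ev' (Gfun _ _ _ h h').
  + by case: tag1_neq0; move: eu'; rewrite eu => /eq_row_mx[].
  + by case: tag1_neq0; move: eu; rewrite eu' => /eq_row_mx[].
  + by rewrite ev ev' (Hfun _ _ _ h h').
- move=> u u' v [[[eu ev] h]|[[eu ev] h]] [[[eu' ev'] h']|[[eu' ev'] h']].
  + by rewrite eu eu' (Ginj _ _ _ h h').
  + by case: tag1_neq0; move: ev'; rewrite ev => /eq_row_mx[].
  + by case: tag1_neq0; move: ev; rewrite ev' => /eq_row_mx[].
  + by rewrite eu eu' (Hinj _ _ _ h h').
Qed.

Lemma setU_iso n (A B : set 'rV[M]_n) :
  definable A -> definable B -> A `&` B = set0 ->
  definably_isomorphic (A `|` B) (setsum A B).
Proof.
move=> dA dB AB; have dis u : A u -> B u -> False.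
  by move=> Au Bu; have : (A `&` B) u by []; rewrite AB.
apply: (@rel_iso _ _ _ _ _ _ (fun u v =>
   (A u /\ v = row_mx (row_mx u 0) 0) \/
   (B u /\ v = row_mx (row_mx 0 u) tag1))); split.
- have t := @ti (n + (n + n + 1)); have tu := tmap_l t; have tv := tmap_r t.
  apply: dor; apply: dand.
  + exact: dsub dA tu.
  + exact: deq tv (tmap_row (tmap_row tu (tmap_cst _ _)) (tmap_cst _ _)).
  + exact: dsub dB tu.
  + exact: deq tv (tmap_row (tmap_row (tmap_cst _ _) tu) (tmap_cst _ _)).
- move=> u v [[Au ->]|[Bu ->]].
    by split; [left|left; exists u].
  by split; [right|right; exists u].
- move=> u [Au|Bu]; [exists (row_mx (row_mx u 0) 0)|
                     exists (row_mx (row_mx 0 u) tag1)]; by [left|right].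
- by move=> v [[u Au <-]|[u Bu <-]]; exists u; [left|right].
- by move=> u v v' [[Au ->]|[Bu ->]] [[Au' ->]|[Bu' ->]] //; case: (dis u).
- move=> u u' v [[Au ->]|[Bu ->]] [[Au']|[Bu']] /eq_row_mx[].
  + by move=> /eq_row_mx[].
  + by move=> _ e; case: tag1_neq0.
  + by move=> _ e; case: tag1_neq0.
  + by move=> /eq_row_mx[].
Qed.

Definition class_add : defclass M -> defclass M -> defclass M :=
  lift_op2 (defclass M) defsetD.
Definition class_mul : defclass M -> defclass M -> defclass M :=
  lift_op2 (defclass M) defsetM.

Lemma class_addE A B : class_add (class A) (class B) = class (defsetD A B).
Proof.
rewrite /class_add; unlock; apply/classP/setsum_iso; apply/classP;
  by rewrite /class reprK.
Qed.

Lemma class_mulE A B : class_mul (class A) (class B) = class (defsetM A B).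
Proof.
rewrite /class_mul; unlock; apply/classP/setprod_iso; apply/classP;
  by rewrite /class reprK.
Qed.

Lemma defclassW (P : defclass M -> Prop) :
  (forall A, P (class A)) -> forall x, P x.
Proof. by move=> h x; rewrite -[x]reprK; exact: h. Qed.

Lemma class_addC : commutative class_add.
Proof.
elim/defclassW => A; elim/defclassW => B; rewrite !class_addE; apply/classP.
have t := @ti (dim A + dim B + 1).
apply: (@tmap_iso _ _ _ _ _ _
  (fun w => row_mx (row_mx (rsubmx (lsubmx w)) (lsubmx (lsubmx w)))
                   (tag1 - rsubmx w))
  (fun w => row_mx (row_mx (rsubmx (lsubmx w)) (lsubmx (lsubmx w)))
                   (tag1 - rsubmx w))).
- exact: (points_definable (defsetD A B)).
- apply: tmap_row; first exact: tmap_row (tmap_r (tmap_l t)) (tmap_l (tmap_l t)).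
  exact: tmapD (tmap_cst _ _) (tmapN (tmap_r t)).
- move=> w [[a Aa <-]|[b Bb <-]]; rewrite !(row_mxKl, row_mxKr, subr0, subrr).
    by split=> //; right; exists a.
  by split=> //; left; exists b.
- move=> w [[a Aa <-]|[b Bb <-]]; rewrite !(row_mxKl, row_mxKr, subr0, subrr).
    by split=> //; right; exists a.
  by split=> //; left; exists b.
Qed.

Lemma class_addA : associative class_add.
Proof.
elim/defclassW => A; elim/defclassW => B; elim/defclassW => C.
rewrite !class_addE; apply/classP.
have t := @ti (dim A + (dim B + dim C + 1) + 1).
apply: (@tmap_iso _ _ _ _ _ _
  (fun w => row_mx (row_mx (row_mx
     (row_mx (lsubmx (lsubmx w)) (lsubmx (lsubmx (rsubmx (lsubmx w)))))
     (rsubmx w - rsubmx (rsubmx (lsubmx w))))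
     (rsubmx (lsubmx (rsubmx (lsubmx w)))))
     (rsubmx (rsubmx (lsubmx w))))
  (fun w => row_mx (row_mx (lsubmx (lsubmx (lsubmx (lsubmx w))))
     (row_mx (row_mx (rsubmx (lsubmx (lsubmx (lsubmx w)))) (rsubmx (lsubmx w)))
             (rsubmx w)))
     (rsubmx (lsubmx (lsubmx w)) + rsubmx w))).
- exact: (points_definable (defsetD A (defsetD B C))).
- have tl := tmap_l t; have tm := tmap_r tl.
  apply: tmap_row (tmap_r tm); apply: tmap_row (tmap_r (tmap_l tm)).
  apply: tmap_row; first exact: tmap_row (tmap_l tl) (tmap_l (tmap_l tm)).
  exact: tmapD (tmap_r t) (tmapN (tmap_r tm)).
- move=> w [[a Aa <-]|[_ [[b Bb <-]|[c Cc <-]] <-]];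
    rewrite !(row_mxKl, row_mxKr, linear0, subr0, subrr, addr0, add0r).
  + split; last by rewrite !row_mx0.
    by left; exists (row_mx (row_mx a 0) 0) => //; left; exists a.
  + split=> //.
    by left; exists (row_mx (row_mx 0 b) tag1) => //; right; exists b.
  + by split; last rewrite ?row_mx0 //; right; exists c; rewrite ?row_mx0.
- move=> w [[_ [[a Aa <-]|[b Bb <-]] <-]|[c Cc <-]];
    rewrite !(row_mxKl, row_mxKr, linear0, subr0, subrr, addr0, add0r).
  + by split; last rewrite ?row_mx0 //; left; exists a; rewrite ?row_mx0.
  + split=> //.
    by right; exists (row_mx (row_mx b 0) 0) => //; left; exists b.
  + split; last by rewrite !row_mx0.
    by right; exists (row_mx (row_mx 0 c) tag1) => //; right; exists c.
Qed.

Lemma class_add0 : left_id (class defset0) class_add.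
Proof.
elim/defclassW => A; rewrite class_addE; apply/classP.
have t := @ti (1 + dim A + 1).
apply: (@tmap_iso _ _ _ _ _ _ (fun w => rsubmx (lsubmx w))
  (fun w => row_mx (row_mx 0 w) tag1)).
- exact: (points_definable (defsetD defset0 A)).
- exact: tmap_r (tmap_l t).
- by move=> w [[a []]|[b Bb <-]]; rewrite row_mxKl row_mxKr.
- by move=> w Aw; rewrite row_mxKl row_mxKr; split=> //; right; exists w.
Qed.

Lemma class_mulC : commutative class_mul.
Proof.
elim/defclassW => A; elim/defclassW => B; rewrite !class_mulE; apply/classP.
have t := @ti (dim A + dim B).
apply: (@tmap_iso _ _ _ _ _ _ (fun w => row_mx (rsubmx w) (lsubmx w))
                              (fun w => row_mx (rsubmx w) (lsubmx w))).
- exact: (points_definable (defsetM A B)).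
- exact: tmap_row (tmap_r t) (tmap_l t).
- move=> w [Aw Bw]; rewrite !(row_mxKl, row_mxKr) hsubmxK; split=> //.
  by split; rewrite ?(row_mxKl, row_mxKr).
- move=> w [Aw Bw]; rewrite !(row_mxKl, row_mxKr) hsubmxK; split=> //.
  by split; rewrite ?(row_mxKl, row_mxKr).
Qed.

Lemma class_mulA : associative class_mul.
Proof.
elim/defclassW => A; elim/defclassW => B; elim/defclassW => C.
rewrite !class_mulE; apply/classP.
have t := @ti (dim A + (dim B + dim C)).
apply: (@tmap_iso _ _ _ _ _ _
  (fun w => row_mx (row_mx (lsubmx w) (lsubmx (rsubmx w))) (rsubmx (rsubmx w)))
  (fun w => row_mx (lsubmx (lsubmx w)) (row_mx (rsubmx (lsubmx w)) (rsubmx w)))).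
- exact: (points_definable (defsetM A (defsetM B C))).
- exact: tmap_row (tmap_row (tmap_l t) (tmap_l (tmap_r t))) (tmap_r (tmap_r t)).
- move=> w [Aw [Bw Cw]]; rewrite !(row_mxKl, row_mxKr) !hsubmxK; split=> //.
  by split; first split; rewrite ?row_mxKl ?row_mxKr.
- move=> w [[Aw Bw] Cw]; rewrite !(row_mxKl, row_mxKr) !hsubmxK; split=> //.
  by split; last split; rewrite ?row_mxKr ?row_mxKl.
Qed.

Lemma class_mul1 : left_id (class defset1) class_mul.
Proof.
elim/defclassW => A; rewrite class_mulE; apply/classP.
have t := @ti (1 + dim A).
apply: (@tmap_iso _ _ _ _ _ _ (fun w => rsubmx w) (fun w => row_mx 0 w)).
- exact: (points_definable (defsetM defset1 A)).
- exact: tmap_r t.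
- by move=> w [w0 Aw]; split=> //; rewrite -[RHS]hsubmxK w0.
- by move=> w Aw; rewrite row_mxKr; split=> //; split; rewrite ?row_mxKl ?row_mxKr.
Qed.

Lemma class_mul0 : left_zero (class defset0) class_mul.
Proof.
elim/defclassW => A; rewrite class_mulE; apply/classP.
apply: (@tmap_iso _ _ _ _ _ _ (fun w => 0) (fun w => 0)).
- exact: (points_definable (defsetM defset0 A)).
- exact: tmap_cst.
- by move=> w [].
- by move=> w [].
Qed.

Lemma class_mulDl : left_distributive class_mul class_add.
Proof.
elim/defclassW => A; elim/defclassW => B; elim/defclassW => C.
rewrite !(class_addE, class_mulE); apply/classP.
have dA := points_definable A; have dB := points_definable B.
have dC := points_definable C.
pose A' : set 'rV[M]_(dim A + dim B + 1) := [set row_mx (row_mx a 0) 0 | a in A].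
pose B' : set 'rV[M]_(dim A + dim B + 1) :=
  [set row_mx (row_mx 0 b) tag1 | b in B].
have t := @ti (dim A + dim B + 1).
have dA' : definable A'.
  apply: (@definable_ext _ _ _ (fun w : 'rV[M]_(dim A + dim B + 1) =>
       points A (lsubmx (lsubmx w)) /\
       w = row_mx (row_mx (lsubmx (lsubmx w)) 0) 0)).
    move=> w; split=> [[Aw e]|[a Aa <-]]; last by rewrite !row_mxKl.
    by exists (lsubmx (lsubmx w)).
  apply: dand; first exact: dsub dA (tmap_l (tmap_l t)).
  exact: deq t (tmap_row (tmap_row (tmap_l (tmap_l t)) (tmap_cst _ _))
                         (tmap_cst _ _)).
have dB' : definable B'.
  apply: (@definable_ext _ _ _ (fun w : 'rV[M]_(dim A + dim B + 1) =>
       points B (rsubmx (lsubmx w)) /\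
       w = row_mx (row_mx 0 (rsubmx (lsubmx w))) tag1)).
    move=> w; split=> [[Bw e]|[b Bb <-]]; last by rewrite row_mxKl row_mxKr.
    by exists (rsubmx (lsubmx w)).
  apply: dand; first exact: dsub dB (tmap_r (tmap_l t)).
  exact: deq t (tmap_row (tmap_row (tmap_cst _ _) (tmap_r (tmap_l t)))
                         (tmap_cst _ _)).
change (definably_isomorphic (setprod (setsum (points A) (points B)) (points C))
  (setsum (setprod (points A) (points C)) (setprod (points B) (points C)))).
have -> : setprod (setsum (points A) (points B)) (points C) = setprod A' C `|` setprod B' C.
  by apply/seteqP; split=> w => [[[h|h] Cw]|[[h Cw]|[h Cw]]];
    [left|right|split=> //; left|split=> //; right].
have dis : setprod A' C `&` setprod B' C = set0.
  apply/seteqP; split=> // w [[[a _ ea] _] [[b _ eb] _]].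
  by case: tag1_neq0; move: eb; rewrite -ea => /eq_row_mx[].
apply: iso_trans (setU_iso _ _ dis) _; try exact: setprod_definable.
apply: setsum_iso; apply: setprod_iso; try exact: iso_refl.
  apply: (@tmap_iso _ _ _ _ _ _ (fun w => lsubmx (lsubmx w))
                               (fun a => row_mx (row_mx a 0) 0)) => //.
  - exact: tmap_l (tmap_l t).
  - by move=> w [a Aa <-]; rewrite !row_mxKl.
  - by move=> a Aa; rewrite !row_mxKl; split=> //; exists a.
apply: (@tmap_iso _ _ _ _ _ _ (fun w => rsubmx (lsubmx w))
                             (fun a => row_mx (row_mx 0 a) tag1)) => //.
- exact: tmap_r (tmap_l t).
- by move=> w [a Aa <-]; rewrite row_mxKl row_mxKr.
- by move=> a Aa; rewrite row_mxKl row_mxKr; split=> //; exists a.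
Qed.

HB.instance Definition _ :=
  GRing.isNmodule.Build (defclass M) class_addA class_addC class_add0.
HB.instance Definition _ := GRing.Nmodule_isComPzSemiRing.Build (defclass M)
  class_mulA class_mulC class_mul1 class_mulDl class_mul0.

End DefinableSemiring.

Lemma class0 (R : nzRingType) : class (defset0 R) = 0.
Proof. by []. Qed.

Lemma class1 (R : nzRingType) : class (defset1 R) = 1.
Proof. by []. Qed.

Lemma classM (R : nzRingType) (A B : defset (right_regular R)) :
  class (defsetM A B) = class A * class B.
Proof. by rewrite -class_mulE. Qed.

Lemma classU (R : nzRingType) n (A B : set 'rV[right_regular R]_n)
    (n_gt0 : (0 < n)%N) (dA : definable A) (dB : definable B)
    (dAB : definable (A `|` B)) :
  A `&` B = set0 ->
  class (DefSet n_gt0 dAB) = class (DefSet n_gt0 dA) + class (DefSet n_gt0 dB).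
Proof.
move=> h; rewrite -[RHS]/(class_add _ _) class_addE; apply/classP.
exact: setU_iso.
Qed.

Section GrothendieckRing.
Variable S : comPzSemiRingType.
Implicit Types x y z : S * S.

(* The pair x stands for the formal difference x.1 - x.2. *)
Definition groth_eq x y : bool :=
  `[< exists e, x.1 + y.2 + e = y.1 + x.2 + e >].

Lemma groth_equiv : equiv_class_of groth_eq.
Proof.
split=> [x|x y|y x z].
- by apply/asboolP; exists 0.
- by apply/asboolP/asboolP => -[e h]; exists e.
- move=> /asboolP[e h] /asboolP[e' h']; apply/asboolP.
  exists (y.1 + y.2 + e + e').
  have -> : x.1 + z.2 + (y.1 + y.2 + e + e') =
            (x.1 + y.2 + e) + (y.1 + z.2 + e') by ring.
  by rewrite h h'; ring.
Qed.

Canonical groth_equiv_rel := EquivRelPack groth_equiv.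

Definition groth := {eq_quot groth_eq}.
HB.instance Definition _ := Choice.on groth.
HB.instance Definition _ := EqQuotient.on groth.

Definition gdiff x : groth := \pi_groth x.

Lemma gdiffP x y :
  gdiff x = gdiff y <-> exists e, x.1 + y.2 + e = y.1 + x.2 + e.
Proof. by split=> [/eqmodP/asboolP //|h]; apply/eqmodP; exact/asboolP. Qed.

Lemma grothW (P : groth -> Prop) : (forall x, P (gdiff x)) -> forall u, P u.
Proof. by move=> h u; rewrite -[u]reprK; exact: h. Qed.

Definition gadd : groth -> groth -> groth :=
  lift_op2 groth (fun x y => (x.1 + y.1, x.2 + y.2)).
Definition gopp : groth -> groth := lift_op1 groth (fun x => (x.2, x.1)).
Definition gmul : groth -> groth -> groth :=
  lift_op2 groth (fun x y => (x.1 * y.1 + x.2 * y.2, x.1 * y.2 + x.2 * y.1)).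

Let gaddE_subproof x y x' y' : gdiff x' = gdiff x -> gdiff y' = gdiff y ->
  gdiff (x'.1 + y'.1, x'.2 + y'.2) = gdiff (x.1 + y.1, x.2 + y.2).
Proof.
move=> /gdiffP[e h] /gdiffP[e' h']; apply/gdiffP => /=; exists (e + e').
have -> : x'.1 + y'.1 + (x.2 + y.2) + (e + e') =
          (x'.1 + x.2 + e) + (y'.1 + y.2 + e') by ring.
by rewrite h h'; ring.
Qed.

Let goppE_subproof x x' :
  gdiff x' = gdiff x -> gdiff (x'.2, x'.1) = gdiff (x.2, x.1).
Proof.
by move=> /gdiffP[e h]; apply/gdiffP; exists e; rewrite /= addrC [RHS]addrC;
   rewrite [x'.2 + _]addrC [x.2 + _]addrC ![e + _]addrC h.
Qed.

Let gmulE_subproof x y x' y' : gdiff x' = gdiff x -> gdiff y' = gdiff y ->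
  gdiff (x'.1 * y'.1 + x'.2 * y'.2, x'.1 * y'.2 + x'.2 * y'.1) =
  gdiff (x.1 * y.1 + x.2 * y.2, x.1 * y.2 + x.2 * y.1).
Proof.
move=> /gdiffP[e h] /gdiffP[e' h'].
transitivity (gdiff (x.1 * y'.1 + x.2 * y'.2, x.1 * y'.2 + x.2 * y'.1));
    apply/gdiffP => /=.
  exists (e * y'.1 + e * y'.2).
  have -> : x'.1 * y'.1 + x'.2 * y'.2 + (x.1 * y'.2 + x.2 * y'.1) +
    (e * y'.1 + e * y'.2) =
    (x'.1 + x.2 + e) * y'.1 + (x.1 + x'.2 + e) * y'.2 by ring.
  have -> : (x'.1 + x.2 + e) * y'.1 + (x.1 + x'.2 + e) * y'.2 =
    (x.1 + x'.2 + e) * y'.1 + (x'.1 + x.2 + e) * y'.2 by rewrite h.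
  by ring.
exists (x.1 * e' + x.2 * e').
have -> : x.1 * y'.1 + x.2 * y'.2 + (x.1 * y.2 + x.2 * y.1) +
    (x.1 * e' + x.2 * e') =
    x.1 * (y'.1 + y.2 + e') + x.2 * (y.1 + y'.2 + e') by ring.
have -> : x.1 * (y'.1 + y.2 + e') + x.2 * (y.1 + y'.2 + e') =
    x.1 * (y.1 + y'.2 + e') + x.2 * (y'.1 + y.2 + e') by rewrite h'.
by ring.
Qed.

Lemma gaddE x y : gadd (gdiff x) (gdiff y) = gdiff (x.1 + y.1, x.2 + y.2).
Proof. by rewrite /gadd; unlock; apply: gaddE_subproof; exact: reprK. Qed.

Lemma goppE x : gopp (gdiff x) = gdiff (x.2, x.1).
Proof. by rewrite /gopp; unlock; apply: goppE_subproof; exact: reprK. Qed.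

Lemma gmulE x y : gmul (gdiff x) (gdiff y) =
  gdiff (x.1 * y.1 + x.2 * y.2, x.1 * y.2 + x.2 * y.1).
Proof. by rewrite /gmul; unlock; apply: gmulE_subproof; exact: reprK. Qed.

Let gext (x y : S * S) : x.1 = y.1 -> x.2 = y.2 -> gdiff x = gdiff y.
Proof. by case: x y => [a b] [c d] /= -> ->. Qed.

Lemma gaddA : associative gadd.
Proof.
elim/grothW => x; elim/grothW => y; elim/grothW => z; rewrite !gaddE.
by apply: gext => /=; ring.
Qed.

Lemma gaddC : commutative gadd.
Proof.
by elim/grothW => x; elim/grothW => y; rewrite !gaddE; apply: gext => /=; ring.
Qed.

Lemma gadd0 : left_id (gdiff (0, 0)) gadd.
Proof. by elim/grothW => x; rewrite !gaddE; apply: gext => /=; ring. Qed.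

Lemma gaddN : left_inverse (gdiff (0, 0)) gopp gadd.
Proof.
elim/grothW => x; rewrite goppE gaddE; apply/gdiffP.
by exists 0 => /=; ring.
Qed.

Lemma gmulA : associative gmul.
Proof.
elim/grothW => x; elim/grothW => y; elim/grothW => z; rewrite !gmulE.
by apply: gext => /=; ring.
Qed.

Lemma gmulC : commutative gmul.
Proof.
by elim/grothW => x; elim/grothW => y; rewrite !gmulE; apply: gext => /=; ring.
Qed.

Lemma gmul1 : left_id (gdiff (1, 0)) gmul.
Proof. by elim/grothW => x; rewrite !gmulE; apply: gext => /=; ring. Qed.

Lemma gmulDl : left_distributive gmul gadd.
Proof.
elim/grothW => x; elim/grothW => y; elim/grothW => z.
by rewrite !(gmulE, gaddE); apply: gext => /=; ring.
Qed.

HB.instance Definition _ := GRing.isZmodule.Build groth gaddA gaddC gadd0 gaddN.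
HB.instance Definition _ :=
  GRing.Zmodule_isComPzRing.Build groth gmulA gmulC gmul1 gmulDl.

Definition groth_inj (a : S) : groth := gdiff (a, 0).

Lemma groth_inj_is_nmod_morphism : nmod_morphism groth_inj.
Proof.
split=> // a b; rewrite -[RHS]/(gadd _ _) gaddE; apply: gext => //=; ring.
Qed.

Lemma groth_inj_is_monoid_morphism : monoid_morphism groth_inj.
Proof.
split=> // a b; rewrite -[RHS]/(gmul _ _) gmulE; apply: gext => /=; ring.
Qed.

HB.instance Definition _ :=
  GRing.isNmodMorphism.Build S groth groth_inj groth_inj_is_nmod_morphism.
HB.instance Definition _ :=
  GRing.isMonoidMorphism.Build S groth groth_inj groth_inj_is_monoid_morphism.

Lemma gdiffE x : gdiff x = groth_inj x.1 - groth_inj x.2.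
Proof.
rewrite -[RHS]/(gadd _ (gopp _)) goppE gaddE; apply: gext => /=; ring.
Qed.

End GrothendieckRing.

Theorem groth_universal (S : comPzSemiRingType) (T : comPzRingType)
    (h : {rmorphism S -> T}) :
  exists2 g : {rmorphism groth S -> T},
    (forall a, g (groth_inj a) = h a) &
    forall g' : {rmorphism groth S -> T},
      (forall a, g' (groth_inj a) = h a) -> g' =1 g.
Proof.
pose g (x : groth S) : T := h (repr x).1 - h (repr x).2.
have gE x : g (gdiff x) = h x.1 - h x.2.
  rewrite /g; have /gdiffP[e /(congr1 h)] : gdiff (repr (gdiff x)) = gdiff x.
    by rewrite /gdiff reprK.
  rewrite !rmorphD => /addIr e'; apply/eqP; rewrite subr_eq addrAC.
  by rewrite -e' addrK.
have gB : zmod_morphism g.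
  elim/grothW => x; elim/grothW => y.
  rewrite -[gdiff x - _]/(gadd _ (gopp _)) goppE gaddE !gE /= !rmorphD.
  by rewrite opprD opprB addrACA.
have gM : monoid_morphism g.
  split; first by rewrite gE /= rmorph1 rmorph0 subr0.
  elim/grothW => x; elim/grothW => y.
  rewrite -[gdiff x * _]/(gmul _ _) gmulE !gE /= !rmorphD !rmorphM.
  ring.
pose zM := GRing.isZmodMorphism.Build _ _ g gB.
pose mM := GRing.isMonoidMorphism.Build _ _ g gM.
pose gR : {rmorphism groth S -> T} := HB.pack g zM mM.
exists gR => [a|g' g'E].
  by rewrite -[LHS]/(g (gdiff _)) gE rmorph0 subr0.
by elim/grothW => x; rewrite -[RHS]/(g _) gE gdiffE rmorphB !g'E.
Qed.

(* The Grothendieck ring of the right R-module R. *)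
Definition K0 (R : nzRingType) : comPzRingType :=
  groth (defclass (right_regular R)).

(* The ring of p-adic integers, as the inverse limit of the rings Z/p^n, n >= 1.
   For p <= 1, 'Z_(p ^ n) is Z/2 by convention, and the limit is junk. *)

Record padic_int (p : nat) := PadicInt {
  residue : forall n : nat, 'Z_(p ^ n.+1);
  residue_compat : forall n, (residue n.+1 : nat)%:R = residue n
}.

HB.instance Definition _ p := gen_eqMixin (padic_int p).
HB.instance Definition _ p := gen_choiceMixin (padic_int p).

Section PadicRing.
Variable p : nat.
Implicit Types x y z : padic_int p.

Lemma padic_intP x y : (forall n, residue x n = residue y n) -> x = y.
Proof.
case: x y => [x hx] [y hy] /= h.
have e : x = y by exact: functional_extensionality_dep.
by move: hx; rewrite e => hx; congr PadicInt; exact: Prop_irrelevance.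
Qed.

Let modulus n := (Zp_trunc (p ^ n.+1)).+2.

Let modulus_dvd n : (modulus n %| modulus n.+1)%N.
Proof.
rewrite /modulus; have [p1|p1] := leqP p 1.
  suff E k : Zp_trunc (p ^ k.+1) = 0%N by rewrite !E.
  rewrite /Zp_trunc -subn2; apply/eqP; rewrite subn_eq0.
  by apply: leq_trans (leqnSn 1); case: p p1 => [|[|]] // _; rewrite ?exp0n ?exp1n.
have E k : ((Zp_trunc (p ^ k.+1)).+2 = p ^ k.+1)%N.
  by apply: Zp_cast; rewrite -(exp1n k.+1) ltn_exp2r.
by rewrite !E [X in (_ %| X)%N]expnS dvdn_mull.
Qed.

Let reduce n (a : 'Z_(p ^ n.+2)) : 'Z_(p ^ n.+1) := (a : nat)%:R.

Let natr_mod n (k : nat) : (k %% modulus n.+1)%:R = k%:R :> 'Z_(p ^ n.+1).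
Proof.
apply: val_inj; rewrite /= !Zp_nat /=.
by rewrite modn_dvdm //; exact: modulus_dvd.
Qed.

Let reduceD n (a b : 'Z_(p ^ n.+2)) : reduce (a + b) = reduce a + reduce b.
Proof. by rewrite /reduce /= natr_mod natrD. Qed.

Let reduceM n (a b : 'Z_(p ^ n.+2)) : reduce (a * b) = reduce a * reduce b.
Proof. by rewrite /reduce /= natr_mod natrM. Qed.

Let reduce1 n : reduce (1 : 'Z_(p ^ n.+2)) = 1.
Proof. by rewrite /reduce. Qed.

Let reduceN n (a : 'Z_(p ^ n.+2)) : reduce (- a) = - reduce a.
Proof.
by apply/eqP; rewrite -addr_eq0 -reduceD addNr /reduce.
Qed.

Let compat x n : reduce (residue x n.+1) = residue x n.
Proof. exact: residue_compat. Qed.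

Definition padic_zero : padic_int p :=
  @PadicInt p (fun n => 0) (fun n => erefl).
Definition padic_one : padic_int p := PadicInt reduce1.
Definition padic_add x y : padic_int p.
Proof.
exists (fun n => residue x n + residue y n) => n.
by have := reduceD (residue x n.+1) (residue y n.+1); rewrite !compat.
Defined.
Definition padic_opp x : padic_int p.
Proof.
exists (fun n => - residue x n) => n.
by have := reduceN (residue x n.+1); rewrite !compat.
Defined.
Definition padic_mul x y : padic_int p.
Proof.
exists (fun n => residue x n * residue y n) => n.
by have := reduceM (residue x n.+1) (residue y n.+1); rewrite !compat.
Defined.

Lemma padic_addA : associative padic_add.
Proof. by move=> x y z; apply: padic_intP => n /=; rewrite addrA. Qed.
Lemma padic_addC : commutative padic_add.
Proof. by move=> x y; apply: padic_intP => n /=; rewrite addrC. Qed.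
Lemma padic_add0 : left_id padic_zero padic_add.
Proof. by move=> x; apply: padic_intP => n /=; rewrite add0r. Qed.
Lemma padic_addN : left_inverse padic_zero padic_opp padic_add.
Proof. by move=> x; apply: padic_intP => n /=; rewrite addNr. Qed.
Lemma padic_mulA : associative padic_mul.
Proof. by move=> x y z; apply: padic_intP => n /=; rewrite mulrA. Qed.
Lemma padic_mulC : commutative padic_mul.
Proof. by move=> x y; apply: padic_intP => n /=; rewrite mulrC. Qed.
Lemma padic_mul1 : left_id padic_one padic_mul.
Proof. by move=> x; apply: padic_intP => n /=; rewrite mul1r. Qed.
Lemma padic_mulDl : left_distributive padic_mul padic_add.
Proof. by move=> x y z; apply: padic_intP => n /=; rewrite mulrDl. Qed.
Lemma padic_1neq0 : padic_one != padic_zero.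
Proof. by apply/eqP => /(congr1 (fun x => residue x 0)) /eqP; rewrite /= oner_eq0. Qed.

HB.instance Definition _ := GRing.isZmodule.Build (padic_int p)
  padic_addA padic_addC padic_add0 padic_addN.
HB.instance Definition _ := GRing.Zmodule_isComNzRing.Build (padic_int p)
  padic_mulA padic_mulC padic_mul1 padic_mulDl padic_1neq0.

End PadicRing.

Definition ideal_pred1X (p : nat) (q : {poly int}) : bool :=
  `[< exists r, q = r * ((p%:R - 1) * 'X) >].

Lemma ideal_pred1X_closed p : idealr_closed (ideal_pred1X p).
Proof.
split.
- by apply/asboolP; exists 0; rewrite mul0r.
- apply/asboolP => -[r /(congr1 (fun q => q.[0]))].
  by rewrite mulrA hornerMX mulr0 hornerE => /eqP; rewrite oner_eq0.
- move=> a u v /asboolP[r ->] /asboolP[s ->]; apply/asboolP.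
  by exists (a * r + s); rewrite [RHS]mulrDl -(mulrA a).
Qed.

HB.instance Definition _ p :=
  isIdealr.Build {poly int} (ideal_pred1X p) (ideal_pred1X_closed p).

Definition ZX_mod_pred1X (p : nat) : comNzRingType :=
  {ideal_quot (ideal_pred1X p : idealr {poly int})}.

(* Main.v *)
Require Import Defs.
From HB Require Import structures.
From mathcomp Require Import all_boot all_order all_algebra ring.
From mathcomp Require Import boolp classical_sets functions.

(* In K0(Zp), let x be the class of the line Zp.  Zp is the disjoint union of
   the p cosets of pZp, each definably isomorphic to Zp, so p x = x.  By
   quantifier elimination a definable set is a Boolean combination of sets
   given by finitely many conditions d | t with t affine (d = 0 being
   the equation t = 0), and such a set is, over its projection forgetting the
   first coordinate, a graph or a disjoint union of products with cosets of
   p^L Zp.  Hence every class is an integer polynomial in x.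

   Conversely, in any commutative ring with an element X such that p X = X,
   there is a finitely additive integral of tame functions on Zp in which points
   have volume 1 and Zp has volume X.  Iterating it defines a volume in every
   dimension, and Fubini's theorem makes the volume invariant under definable
   bijections, by integrating the indicator function of the graph in both
   orders.  The volume valued in Z[X]/((p-1)X) inverts X |-> x. *)

Set Implicit Arguments.
Unset Strict Implicit.
Unset Printing Implicit Defensive.

Import GRing.Theory.

Local Open Scope ring_scope.

(** * Arithmetic of the p-adic integers *)

Definition divides (R : comNzRingType) (x y : R) := exists z, y = z * x.

Section PadicArithmetic.
Variable p : nat.
Hypothesis p_prime : prime p.
Local Notation Zp := (padic_int p).
Local Notation q L := ((p ^ L)%N%:R : Zp).
Implicit Types x y z : Zp.

Lemma expp_gt0 L : (0 < p ^ L)%N.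
Proof. by rewrite expn_gt0 prime_gt0. Qed.

Lemma Zp_modulus k : ((Zp_trunc (p ^ k.+1)).+2 = p ^ k.+1)%N.
Proof. by apply: Zp_cast; rewrite -(exp1n k.+1) ltn_exp2r // prime_gt1. Qed.

Lemma val_Zp_natr k m : (m%:R : 'Z_(p ^ k.+1)) = (m %% p ^ k.+1)%N :> nat.
Proof. by rewrite Zp_nat /= Zp_modulus. Qed.

(** Residues start at Z/p, so the index is shifted by one and a trivial level 0 is added;
    [trunc L x] is then the representative of x modulo p^L for every L. *)
Definition trunc L x : nat := if L is k.+1 then residue x k else 0%N.

Lemma trunc_lt L x : (trunc L x < p ^ L)%N.
Proof.
case: L => [|k] //=; have := ltn_ord (residue x k).
by move/leq_trans; apply; rewrite Zp_modulus.
Qed.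

Lemma truncS L x : trunc L x = (trunc L.+1 x %% p ^ L)%N.
Proof.
case: L => [|k] /=; first by rewrite modn1.
by rewrite -(residue_compat x k) val_Zp_natr.
Qed.

Lemma trunc_mod L N x : (L <= N)%N -> trunc L x = (trunc N x %% p ^ L)%N.
Proof.
move=> /subnK <-; elim: (N - L)%N => [|k IH]; first by rewrite modn_small ?trunc_lt.
rewrite IH truncS modn_dvdm //; exact: dvdn_exp2l (leq_addl _ _).
Qed.

Lemma trunc_inj x y : (forall L, trunc L x = trunc L y) -> x = y.
Proof. by move=> h; apply: padic_intP => n; apply: val_inj; exact: (h n.+1). Qed.

Lemma truncD L x y : trunc L (x + y) = ((trunc L x + trunc L y) %% p ^ L)%N.
Proof. by case: L => [|k] /=; [rewrite modn1|congr (_ %% _)%N; exact: Zp_modulus]. Qed.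

Lemma truncM L x y : trunc L (x * y) = ((trunc L x * trunc L y) %% p ^ L)%N.
Proof. by case: L => [|k] /=; [rewrite modn1|congr (_ %% _)%N; exact: Zp_modulus]. Qed.

Lemma trunc0 L : trunc L 0 = 0%N.
Proof. by case: L. Qed.

Lemma trunc_nat L n : trunc L n%:R = (n %% p ^ L)%N.
Proof.
elim: n => [|n IH]; first by rewrite trunc0 mod0n.
rewrite -addn1 natrD truncD IH.
have -> : trunc L 1 = (1 %% p ^ L)%N.
  by case: L {IH} => [|k]; [rewrite modn1|exact: (@val_Zp_natr k 1)].
by rewrite modnDm.
Qed.

(** Glues approximations into a p-adic integer; division by p^L and inversion of units are both
    carried out one level at a time. *)
Lemma padic_of_seq (a : nat -> nat) :
  (forall n, a n.+1 = a n %[mod p ^ n.+1]) ->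
  exists z, forall n, trunc n.+1 z = (a n %% p ^ n.+1)%N.
Proof.
move=> h; pose r n : 'Z_(p ^ n.+1) := (a n)%:R.
have rE n : (r n : nat) = (a n %% p ^ n.+1)%N := val_Zp_natr n (a n).
have c n : (r n.+1 : nat)%:R = r n.
  apply: val_inj; rewrite [LHS]val_Zp_natr [RHS]rE rE.
  by rewrite modn_dvdm ?dvdn_exp2l // h.
by exists (PadicInt c) => n /=.
Qed.


(** If p^L divides one truncation it divides all later ones; the quotient modulo p^(n+1) is read off
    L levels higher. *)
Lemma trunc_eq0 L x : divides (q L) x <-> trunc L x = 0%N.
Proof.
split=> [[z ->]|h]; first by rewrite truncM trunc_nat modnn muln0 mod0n.
have dv n : (p ^ L %| trunc (L + n) x)%N.
  by rewrite /dvdn -(@trunc_mod _ (L + n)%N) ?leq_addr // h.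
have [n|z hz] := @padic_of_seq (fun n => trunc (L + n.+1) x %/ p ^ L)%N.
  apply/eqP; rewrite -(eqn_pmul2r (expp_gt0 L)) !muln_modl ?expp_gt0 //.
  rewrite !divnK // -expnD -(@trunc_mod (n.+1 + L)) ?(addnC L) ?leqnn //.
  by rewrite -trunc_mod // leq_add2r.
exists z; apply: trunc_inj => -[|n] //; rewrite truncM trunc_nat modnMmr hz.
rewrite modnMml divnK // -trunc_mod //; exact: leq_addl.
Qed.

Lemma trunc_nat_eq L x : divides (q L) (x - (trunc L x)%:R).
Proof.
apply/trunc_eq0.
have : trunc L (x - (trunc L x)%:R + (trunc L x)%:R) = trunc L x by rewrite subrK.
rewrite truncD trunc_nat (modn_small (trunc_lt L x)) => /eqP.
rewrite -[X in _ == X](modn_small (trunc_lt L x)) -[X in _ == (X %% _)%N]add0n.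
by rewrite eqn_modDr mod0n modn_small ?trunc_lt // => /eqP.
Qed.

Lemma trunc_eqP L x y : trunc L x = trunc L y <-> divides (q L) (x - y).
Proof.
rewrite trunc_eq0; split=> h.
  have : trunc L (x - y + y) = trunc L y by rewrite subrK.
  rewrite truncD => /eqP.
  rewrite -[X in _ == X](modn_small (trunc_lt L y)) -[X in _ == (X %% _)%N]add0n.
  by rewrite eqn_modDr mod0n modn_small ?trunc_lt // => /eqP.
by rewrite -[x](subrK y) truncD h add0n modn_small ?trunc_lt.
Qed.

(** At level n + L the hypothesis says that p^(n+L) divides p^L times a truncation of x, and p^L
    cancels there. *)
Lemma mulq_eq0 L x : q L * x = 0 -> x = 0.
Proof.
move=> h; apply: trunc_inj => n; rewrite trunc0.
have /eqP : trunc (n + L) (q L * x) = 0%N by rewrite h trunc0.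
rewrite truncM trunc_nat modnMml expnD -/(_ %| _)%N mulnC dvdn_pmul2l ?expp_gt0 //.
by move=> /eqP; rewrite -trunc_mod // leq_addr.
Qed.

(** Bezout inverts x modulo every p^(n+1); the inverses are compatible because the truncations of x,
    being prime to p, can be cancelled. *)
Lemma padic_unit x : trunc 1 x <> 0%N -> exists y, x * y = 1.
Proof.
move=> h.
have cop n : coprime (trunc n.+1 x) (p ^ n.+1).
  rewrite coprime_sym coprimeXl // prime_coprime // /dvdn.
  by apply/eqP => e; apply: h; rewrite (@trunc_mod _ n.+1) // expn1.
have tpos n : (0 < trunc n.+1 x)%N.
  rewrite lt0n; apply/eqP => e; apply: h.
  by rewrite (@trunc_mod _ n.+1) // e mod0n.
pose a n := (egcdn (trunc n.+1 x) (p ^ n.+1)).1.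
have aE n : (a n * trunc n.+1 x = 1 %[mod p ^ n.+1])%N.
  rewrite /a; case: egcdnP => // u v /= -> _.
  by rewrite (eqP (cop n)) modnMDl.
have [n|z hz] := @padic_of_seq a.
  have : (a n.+1 * trunc n.+1 x = a n * trunc n.+1 x %[mod p ^ n.+1])%N.
    rewrite aE (@trunc_mod n.+1 n.+2) // modnMmr -(@modn_dvdm (p ^ n.+2)) ?aE ?dvdn_exp2l //.
    by rewrite modn_dvdm ?dvdn_exp2l.
  move/eqP; rewrite -!(mulnC (trunc n.+1 x)).
  (* Subtraction of natural numbers is truncated, so the congruence becomes a divisibility only once
     the two sides are ordered. *)
  wlog le : / (a n <= a n.+1)%N.
    move=> H; have [le|/ltnW le] := leqP (a n) (a n.+1); first exact: H.
    rewrite eq_sym eqn_mod_dvd ?leq_mul2l ?le ?orbT // -mulnBr Gauss_dvdr; last first.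
      by rewrite coprime_sym.
    by rewrite -eqn_mod_dvd // => /eqP.
  rewrite eqn_mod_dvd ?leq_mul2l ?le ?orbT // -mulnBr Gauss_dvdr; last first.
    by rewrite coprime_sym.
  by rewrite -eqn_mod_dvd // => /eqP.
exists z; apply: trunc_inj => -[|n] //.
by rewrite truncM hz modnMmr mulnC aE -(trunc_nat n.+1 1).
Qed.

(** The least level at which x is nonzero is v + 1; p^v divides x, and the cofactor is a unit since
    p^(v+1) does not divide x. *)
Lemma padic_factor x : x <> 0 -> exists v u w, x = q v * u /\ u * w = 1.
Proof.
move=> x0.
have [L hL] : exists L, trunc L x != 0%N.
  apply: contra_notP x0 => h; apply: trunc_inj => L; rewrite trunc0.
  by apply: contra_notP h => /eqP h; exists L.
have [[|v] hv vmin] := ex_minnP (ex_intro (fun L => trunc L x != 0%N) L hL); first by [].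
have /trunc_eq0[u xu] : trunc v x = 0%N.
  apply/eqP; apply: contraT => /vmin; by rewrite ltnn.
have [|w uw] := @padic_unit u; last by exists v, u, w; rewrite mulrC.
move=> u0; move/eqP: hv; apply; apply/trunc_eq0.
have /trunc_eq0[z uz] := u0; exists z.
by rewrite xu uz expn1 expnSr natrM; ring.
Qed.

Lemma padic_mul_eq0 x y : x * y = 0 -> x = 0 \/ y = 0.
Proof.
move=> xy; case: (pselect (x = 0)) => [|/padic_factor[v [u [w [xE uw]]]]]; first by left.
right; apply: (@mulq_eq0 v).
have -> : q v * y = (x * y) * w + q v * y * (1 - u * w) by rewrite xE; ring.
by rewrite xy uw subrr mul0r mulr0 addr0.
Qed.

Lemma padic_mulI x y z : x <> 0 -> x * y = x * z -> y = z.
Proof.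
move=> x0 /eqP; rewrite -subr_eq0 -mulrBr => /eqP /padic_mul_eq0[//|/eqP].
by rewrite subr_eq0 => /eqP.
Qed.

End PadicArithmetic.

(** * Quantifier elimination *)

HB.instance Definition _ (R M : Type) := gen_eqMixin (term R M).

Section Atoms.
Variable R : comNzRingType.
Local Notation M := (right_regular R).
Implicit Types (e : nat -> M) (t : term R M) (x y z : R).

(** Terms are affine: [coef0] and [tail] split off the contribution of variable 0, and [tail] lowers
    the other indices. *)
Fixpoint coef0 t : R :=
  match t with
  | Var i => (i == 0%N)%:R
  | Param _ | Zero => 0
  | Add t u => coef0 t + coef0 u
  | Opp t => - coef0 t
  | Act t r => coef0 t * r
  end.

Fixpoint tail t : term R M :=
  match t with
  | Var i => if i is j.+1 then Var j else Zero
  | Param c => Param c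
  | Zero => Zero
  | Add t u => Add (tail t) (tail u)
  | Opp t => Opp (tail t)
  | Act t r => Act (tail t) r
  end.

Lemma eval_scons (y : R) e t :
  eval (scons (y : M) e) t = coef0 t * y + (eval e (tail t) : R) :> R.
Proof.
(* The [transitivity] steps replace the operations of M by those of R. *)
elim: t => [[|i]|c||t IHt u IHu|t IHt|t IHt r] /=.
- by rewrite mul1r; symmetry; exact: addr0.
- by rewrite mul0r add0r.
- by rewrite mul0r add0r.
- by rewrite mul0r; symmetry; exact: addr0.
- transitivity ((eval (scons (y : M) e) t : R) + (eval (scons (y : M) e) u : R)) => //.
  rewrite IHt IHu.
  transitivity ((coef0 t + coef0 u) * y +
                ((eval e (tail t) : R) + (eval e (tail u) : R))) => //.
  by ring.
- transitivity (- (eval (scons (y : M) e) t : R)) => //; rewrite IHt.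
  transitivity (- coef0 t * y + - (eval e (tail t) : R)) => //.
  by ring.
- transitivity ((eval (scons (y : M) e) t : R) * r) => //; rewrite IHt.
  transitivity (coef0 t * r * y + (eval e (tail t) : R) * r) => //.
  by ring.
Qed.

(* The atom (d, t) expresses d | t; it is the equation t = 0 when d = 0. *)
Definition atom := (R * term R M)%type.

Definition sat e (a : atom) := divides a.1 (eval e a.2).

(* For a nonzero, if a y + s = 0 then d | b y + t iff a d | t a - s b. *)
Definition subst_atom (a b : atom) : atom :=
  (coef0 a.2 * b.1,
        Add (Act (tail b.2) (coef0 a.2)) (Opp (Act (tail a.2) (coef0 b.2)))).

Lemma sat_subst e (a b : atom) : sat e (subst_atom a b) <->
  divides (coef0 a.2 * b.1)
    ((eval e (tail b.2) : R) * coef0 a.2 + - ((eval e (tail a.2) : R) * coef0 b.2)).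
Proof. by []. Qed.

Definition nat_atom (a : atom) (r : nat) : atom :=
  (a.1, Add (Param (coef0 a.2 * r%:R : M)) (tail a.2)).

Lemma sat_nat (a : atom) r e :
  sat (scons (r%:R : M) e) a <-> sat e (nat_atom a r).
Proof. by rewrite /sat eval_scons. Qed.

Definition basic (l : seq atom) e := forall a, a \in l -> sat e a.

Definition same_type (l : seq atom) e e' :=
  forall a, a \in l -> (sat e a <-> sat e' a).

Lemma divides0 x : divides 0 x <-> x = 0.
Proof. by split=> [[z ->]|->]; [rewrite mulr0|exists 0; rewrite mulr0]. Qed.

Lemma divides_trans x y z : divides x y -> divides y z -> divides x z.
Proof. by move=> [u ->] [v ->]; exists (v * u); rewrite mulrA. Qed.

Lemma dividesMl x y z : divides x y -> divides x (z * y).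
Proof. by move=> [u ->]; exists (z * u); rewrite mulrA. Qed.

Lemma dividesD x y z : divides x y -> divides x z -> divides x (y + z).
Proof. by move=> [u ->] [v ->]; exists (u + v); rewrite mulrDl. Qed.

Lemma dividesBr x y z : divides x (y - z) -> divides x y <-> divides x z.
Proof.
move=> h; split=> h'; last by rewrite -(subrK z y); exact: dividesD.
by rewrite (_ : z = y + (-1) * (y - z)); [apply: dividesD h' (dividesMl _ h)|ring].
Qed.

Lemma basic_cons a l e : basic (a :: l) e <-> sat e a /\ basic l e.
Proof.
split=> [h|[h h'] b]; last by rewrite inE => /orP[/eqP->|/h'].
by split=> [|b bl]; apply: h; rewrite inE ?eqxx // bl orbT.
Qed.

End Atoms.

Section QuantifierElimination.
Variable p : nat.
Hypothesis p_prime : prime p.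
Local Notation Zp := (padic_int p).
Local Notation M := (right_regular Zp).
Local Notation q L := ((p ^ L)%N%:R : Zp).
Implicit Types (e : nat -> M) (t : term Zp M) (l : seq (atom Zp)).

Lemma natr_inj : injective (fun n : nat => n%:R : Zp).
Proof.
move=> n m /(congr1 (trunc (n + m))); rewrite !trunc_nat //.
by rewrite !modn_small //; apply: leq_ltn_trans (ltn_expl _ (prime_gt1 p_prime));
  rewrite ?leq_addr ?leq_addl.
Qed.

Lemma q_neq0 L : q L <> 0.
Proof. by move=> /(@natr_inj _ 0%N)/eqP; rewrite expn_eq0 eqn0Ngt prime_gt0. Qed.

(** Pigeonhole: the points y0 + n p^L with n at most the size of s are distinct and outnumber s. *)
Lemma coset_avoid (s : seq Zp) (y0 : Zp) L :
  exists y, divides (q L) (y - y0) /\ y \notin s.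
Proof.
pose f n : Zp := y0 + n%:R * q L.
have f_inj : injective f.
  move=> n m /addrI; rewrite ![_ * q L]mulrC => /(padic_mulI p_prime (q_neq0 (L:=L))).
  exact: natr_inj.
suff [y [n ->] ys] : exists2 y, exists n, y = f n & y \notin s.
  exists (f n); split=> //; exists n%:R; rewrite /f; ring.
pose u := [seq f i | i <- iota 0 (size s).+1].
have [/hasP[y /mapP[n _ ->] ys]|] := boolP (has (fun y => y \notin s) u).
  by exists (f n) => //; exists n.
rewrite -all_predC => /allP sub.
have : (size u <= size s)%N.
  apply: uniq_leq_size; first by rewrite map_inj_uniq ?iota_uniq.
  by move=> y /sub /=; rewrite negbK.
by rewrite size_map size_iota ltnn.
Qed.

Lemma divides_pow (d : Zp) : d <> 0 ->
  exists L0, forall L, (L0 <= L)%N -> divides d (q L).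
Proof.
move=> /(padic_factor p_prime)[v [u [w [-> uw]]]]; exists v => L vL.
exists (q (L - v) * w); rewrite -[in LHS](subnK vL) expnD natrM.
have -> : q (L - v) * w * (q v * u) = q (L - v) * q v * (u * w) by ring.
by rewrite uw mulr1.
Qed.

Lemma common_pow l :
  exists L, forall a, a \in l -> a.1 <> 0 -> divides a.1 (q L).
Proof.
suff [L0 h] : exists L0, forall L, (L0 <= L)%N ->
    forall a, a \in l -> a.1 <> 0 -> divides a.1 (q L).
  by exists L0; exact: h.
elim: l => [|a l [N hN]]; first by exists 0%N.
have [K hK] : exists L0, forall L, (L0 <= L)%N -> a.1 <> 0 -> divides a.1 (q L).
  case: (pselect (a.1 = 0)) => [a0|/divides_pow[K hK]]; first by exists 0%N.
  by exists K => L /hK.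
exists (maxn K N) => L; rewrite geq_max => /andP[KL NL] b.
by rewrite inE => /orP[/eqP->|]; [exact: hK|exact: hN].
Qed.

(* The truth values of these atoms at e determine which truth assignments to l
   are realized at (y, e) by some y: if an equation of l holds at (y, e), it
   determines y; otherwise only y mod p^L matters, as y can be moved away from
   the solutions of the finitely many equations. *)
Definition elim_atoms L l : seq (atom Zp) :=
  [seq (a.1, tail a.2) | a <- l] ++ [seq (coef0 a.2, tail a.2) | a <- l] ++
  [seq subst_atom a b | a <- l, b <- l] ++
  [seq nat_atom a r | a <- l, r <- iota 0 (p ^ L)].

(** Multiply the condition by a, eliminate a y by the equation, and cancel a, which is possible in a
    domain. *)
Lemma divides_subst (a d b s t y : Zp) : a <> 0 -> a * y + s = 0 ->
  divides d (b * y + t) <-> divides (a * d) (t * a + - (s * b)).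
Proof.
move=> a0 ays.
have -> : t * a + - (s * b) = a * (b * y + t) - b * (a * y + s) by ring.
rewrite ays mulr0 subr0; split=> [[z ->]|[z]]; first by exists z; ring.
rewrite (_ : z * (a * d) = a * (z * d)); last by ring.
by move=> /(padic_mulI p_prime a0) ->; exists z.
Qed.

Lemma sat_shift L (a : atom Zp) (y y' : Zp) e :
  divides a.1 (q L) -> divides (q L) (y - y') ->
  sat (scons (y : M) e) a <-> sat (scons (y' : M) e) a.
Proof.
move=> h h'; apply: dividesBr; rewrite !eval_scons.
have -> : forall s, coef0 a.2 * y + s - (coef0 a.2 * y' + s) = coef0 a.2 * (y - y').
  by move=> s; ring.
exact: dividesMl (divides_trans h h').
Qed.

Lemma back_and_forth L l e e' :
  (forall a, a \in l -> a.1 <> 0 -> divides a.1 (q L)) ->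
  same_type (elim_atoms L l) e e' ->
  forall y : Zp, exists y' : Zp, same_type l (scons (y : M) e) (scons (y' : M) e').
Proof.
move=> hL same y.
have sameE a : a \in l -> sat e (a.1, tail a.2) <-> sat e' (a.1, tail a.2).
  by move=> al; apply: same; rewrite mem_cat map_f.
have sameC a : a \in l -> sat e (coef0 a.2, tail a.2) <-> sat e' (coef0 a.2, tail a.2).
  by move=> al; apply: same; rewrite !mem_cat (map_f (fun a => (coef0 a.2, tail a.2))) ?orbT.
case: (pselect (exists2 a, a \in l &
    [/\ a.1 = 0, coef0 a.2 <> 0 & sat (scons (y : M) e) a])).
  move=> [a al [ad a0 hy]]; move: hy; rewrite /sat ad divides0 eval_scons => hy.
  (* The equation is solvable over e, that is, its coefficient divides its constant part; the same
     holds over e', with solution - z. *)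
  have [z hz] : sat e' (coef0 a.2, tail a.2).
    apply/(sameC _ al); exists (- y) => /=.
    by rewrite mulNr (mulrC y) -[LHS](addKr (coef0 a.2 * y)) hy addr0.
  rewrite /= in hz.
  have hy' : coef0 a.2 * - z + (eval e' (tail a.2) : Zp) = 0.
    by rewrite hz; ring.
  exists (- z : Zp) => b bl; rewrite /sat !eval_scons.
  rewrite (divides_subst _ _ _ a0 hy) (divides_subst _ _ _ a0 hy').
  rewrite -!sat_subst; apply: same.
  by rewrite !mem_cat (allpairs_f (@subst_atom Zp)) ?orbT.
move=> none.
(* One solution over e' for each atom, 0 if there is none. The new point lies in the class of y
   modulo p^L and avoids this list, hence violates every equation that involves it. *)
pose sols := [seq xget (0 : Zp) (fun y' : Zp =>
   coef0 a.2 * y' + (eval e' (tail a.2) : Zp) = 0) | a <- l].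
have [y' [yy' y's]] := coset_avoid sols (trunc L y)%:R L.
exists y' => a al.
case: (pselect (a.1 = 0)) => [ad|ad]; last first.
  have ay := hL _ al ad.
  rewrite (sat_shift e ay (trunc_nat_eq p_prime L y)) (sat_shift e' ay yy') !sat_nat.
  apply: same; rewrite !mem_cat.
  rewrite (allpairs_f (@nat_atom Zp)) ?orbT //.
  by rewrite mem_iota /= trunc_lt.
case: (pselect (coef0 a.2 = 0)) => a0.
  have := sameE _ al; rewrite /sat !eval_scons a0 !mul0r !add0r; exact.
split=> [h|]; first by case: none; exists a.
rewrite /sat ad divides0 eval_scons => h; case/negP: y's; apply/mapP; exists a => //.
case: xgetP => [z _ hz|/(_ y')//]; apply: (padic_mulI p_prime a0).
by apply: (addIr (eval e' (tail a.2) : Zp)); rewrite h hz.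
Qed.

(** A semantic substitute for Boolean combinations of the atoms in l. One implication suffices since
    [same_type] is symmetric. *)
Definition determined l (S : (nat -> M) -> Prop) :=
  forall e e', same_type l e e' -> S e -> S e'.

Lemma same_type_sym l e e' : same_type l e e' -> same_type l e' e.
Proof. by move=> h a al; apply: iff_sym; exact: h. Qed.

Lemma determined_sub l l' S : {subset l <= l'} -> determined l S -> determined l' S.
Proof. by move=> sub h e e' same; apply: h => a /sub; exact: same. Qed.

Lemma determined_ex l (S : (nat -> M) -> Prop) : determined l S ->
  exists l', determined l' (fun e => exists y, S (scons (y : M) e)).
Proof.
move=> hS; have [L hL] := common_pow l; exists (elim_atoms L l) => e e' same [y hy].
by have [y' hy'] := back_and_forth hL same y; exists y'; exact: hS hy' hy.
Qed.

Lemma determined_neg l (S : (nat -> M) -> Prop) :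
  determined l S -> determined l (fun e => ~ S e).
Proof. by move=> hS e e' /same_type_sym same h /(hS _ _ same). Qed.

(** Quantifier elimination. Connectives merge the lists of atoms, the back-and-forth step handles
    the existential quantifier, and the universal one follows by negation. *)
Theorem formula_determined (f : formula Zp M) :
  exists l, determined l (fun e => holds e f).
Proof.
have join (g h : formula Zp M) : (exists l, determined l (fun e => holds e g)) ->
    (exists l, determined l (fun e => holds e h)) ->
  exists l, determined l (fun e => holds e g) /\ determined l (fun e => holds e h).
  move=> [l hl] [l' hl']; exists (l ++ l').
  by split; [apply: determined_sub hl|apply: determined_sub hl'] => a;
    rewrite mem_cat => ->; rewrite ?orbT.
elim: f => /= [|t u|f [l hl]|f IHf g IHg|f IHf g IHg|f IHf g IHg|f [l hl]|f [l hl]].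
- by exists [::].
- exists [:: (0, Add t (Opp u))] => e e' /(_ _ (mem_head _ _)).
  rewrite /sat /= !divides0 => h tu.
  apply/eqP; rewrite -subr_eq0; apply/eqP; apply/h.
  by apply/eqP; rewrite subr_eq0; apply/eqP.
- by exists l; exact: determined_neg.
- have [l [hf hg]] := join _ _ IHf IHg; exists l => e e' s [h h'].
  by split; [exact: hf s h|exact: hg s h'].
- have [l [hf hg]] := join _ _ IHf IHg; exists l => e e' s [h|h].
    by left; exact: hf s h.
  by right; exact: hg s h.
- have [l [hf hg]] := join _ _ IHf IHg; exists l => e e' s h h'.
  by apply: (hg _ _ s); apply: h; apply: (hf _ _ (same_type_sym s)).
- have [l' hl'] := determined_ex (determined_neg hl); exists l' => e e' s h x.
  apply: contrapT => nx; have [|y []] := hl' _ _ (same_type_sym s); last exact: h.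
  by exists x.
- exact: determined_ex hl.
Qed.

End QuantifierElimination.

(** * Sets defined by divisibility conditions *)

Section Vcons.
Variable R : comNzRingType.
Local Notation M := (right_regular R).

(** The new coordinate has index 0, so that [vcons] on points matches [scons] on environments. *)
Definition vcons n (y : M) (v : 'rV[M]_n) : 'rV[M]_n.+1 :=
  row_mx (const_mx y : 'rV[M]_1) v.

Definition vtail n (w : 'rV[M]_n.+1) : 'rV[M]_n := rsubmx (w : 'rV[M]_(1 + n)).

Lemma vconsK n (w : 'rV[M]_n.+1) : vcons (w 0 0) (vtail w) = w.
Proof.
have e : const_mx (w 0 0) = lsubmx (w : 'rV[M]_(1 + n)).
  by apply/rowP => i; rewrite !mxE (ord1 i); congr (w _ _); apply: val_inj.
rewrite /vcons e /vtail; exact: (@hsubmxK M 1 1 n w).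
Qed.

Lemma vcons0 n y (v : 'rV[M]_n) : vcons y v 0 0 = y.
Proof.
have -> : (0 : 'I_n.+1) = lshift n (0 : 'I_1) by exact: val_inj.
by transitivity ((const_mx y : 'rV[M]_1) 0 0); [exact: row_mxEl|rewrite mxE].
Qed.

Lemma vconsS n y (v : 'rV[M]_n) i : vcons y v 0 (rshift 1 i) = v 0 i.
Proof. exact: row_mxEr. Qed.

Lemma vtailK n y (v : 'rV[M]_n) : vtail (vcons y v) = v.
Proof. by rewrite /vtail row_mxKr. Qed.

Lemma env_vcons n y (v : 'rV[M]_n) : env (vcons y v) = scons y (env v).
Proof.
apply/funext => -[|i] /=.
  by rewrite -[0%N]/(nat_of_ord (0 : 'I_n.+1)) env_ord vcons0.
have [hi|hi] := ltnP i n; last by rewrite !env_ge.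
rewrite -[i.+1]/(nat_of_ord (rshift 1 (Ordinal hi))) env_ord vconsS.
by rewrite -[i in RHS]/(nat_of_ord (Ordinal hi)) env_ord.
Qed.

Lemma vcons_row n m y (u : 'rV[M]_n) (v : 'rV[M]_m) :
  vcons y (row_mx u v) = row_mx (vcons y u) v.
Proof.
apply/rowP => i; rewrite -[i](@splitK n.+1 m); case: (fintype.split _) => [j|j] /=.
  transitivity (vcons y u 0 j); last by symmetry; exact: row_mxEl.
  have [->|[k ->]] : j = 0 \/ exists k, j = rshift 1 k.
    case: j => -[|j] jn; first by left; apply: val_inj.
    by right; exists (Ordinal (jn : (j < n)%N)); apply: val_inj.
  - have -> : lshift m (0 : 'I_n.+1) = 0 :> 'I_(n + m).+1 by exact: val_inj.
    by rewrite !vcons0.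
  have -> : lshift m (rshift 1 k : 'I_n.+1) = rshift 1 (lshift m k) by exact: val_inj.
  by rewrite !vconsS row_mxEl.
transitivity (v 0 j); last by symmetry; exact: row_mxEr.
have -> : rshift n.+1 j = rshift 1 (rshift n j) by exact: val_inj.
by rewrite vconsS row_mxEr.
Qed.

Lemma tmap_vcons n m (h : 'rV[M]_n -> M) (f : 'rV[M]_n -> 'rV[M]_m) :
  tmap (fun v => const_mx (h v) : 'rV[M]_1) -> tmap f ->
  tmap (fun v => vcons (h v) (f v)).
Proof. exact: tmap_row. Qed.

Lemma tmap_head n m (f : 'rV[M]_n -> 'rV[M]_m.+1) :
  tmap f -> tmap (fun v => const_mx (f v 0 0) : 'rV[M]_1).
Proof. by move=> [s hs]; exists (fun=> s 0) => v j; rewrite mxE hs. Qed.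

Lemma tmap_vtail n m (f : 'rV[M]_n -> 'rV[M]_m.+1) :
  tmap f -> tmap (fun v => vtail (f v)).
Proof. exact: (@tmap_r _ _ n 1 m). Qed.

End Vcons.

Section BasicSets.
Variable p : nat.
Hypothesis p_prime : prime p.
Local Notation Zp := (padic_int p).
Local Notation M := (right_regular Zp).
Local Notation q L := ((p ^ L)%N%:R : Zp).
Implicit Types (e : nat -> M) (t : term Zp M) (l : seq (atom Zp)).

(** The dichotomy behind all inductions on the dimension. An equation involving y makes the set a
    graph, the conditions l' ensuring that it is solvable. Otherwise y enters only through
    conditions with nonzero d, which see y modulo a common p^L. *)
Lemma basic_scons l :
  (exists (a : Zp) t l', [/\ a <> 0,
     forall e, basic l' e -> divides a (eval e t : Zp) &
     forall (y : Zp) e, basic l (scons (y : M) e) <->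
       basic l' e /\ a * y + (eval e t : Zp) = 0]) \/
  (exists L (l_ : nat -> seq (atom Zp)), forall (y : Zp) e,
     basic l (scons (y : M) e) <-> basic (l_ (trunc L y)) e).
Proof.
case: (pselect (exists2 a, a \in l & a.1 = 0 /\ coef0 a.2 <> 0)).
  move=> [a al [ad a0]]; left.
  pose s := subst_atom a.
  exists (coef0 a.2), (tail a.2), ((coef0 a.2, tail a.2) :: map s l); split=> //.
    by move=> e /basic_cons[].
  have sP (y : Zp) e b : coef0 a.2 * y + (eval e (tail a.2) : Zp) = 0 ->
      sat (scons (y : M) e) b <-> sat e (s b).
    by move=> h; rewrite sat_subst /sat eval_scons (divides_subst p_prime _ _ _ a0 h).
  move=> y e; split=> [h|[h h'] b bl]; last first.
    by apply/(sP _ _ _ h'); apply: h; rewrite inE map_f ?orbT.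
  have hy : coef0 a.2 * y + (eval e (tail a.2) : Zp) = 0.
    by have := h a al; rewrite /sat ad divides0 eval_scons.
  split=> //; apply/basic_cons; split; last first.
    by move=> _ /mapP[b bl ->]; apply/(sP _ _ _ hy); exact: h.
  exists (- y); rewrite /=; apply/eqP; rewrite -subr_eq0; apply/eqP.
  by rewrite -hy; ring.
move=> none; right; have [L hL] := common_pow p_prime l.
exists L, (fun r => [seq nat_atom a r | a <- l]).
have satE (y : Zp) e a : a \in l -> sat (scons (y : M) e) a <->
    sat e (nat_atom a (trunc L y)).
  move=> al; rewrite -sat_nat; case: (pselect (a.1 = 0)) => [ad|ad].
    have a0 : coef0 a.2 = 0 by apply: contrapT => a0; apply: none; exists a.
    by rewrite /sat !eval_scons a0 !mul0r.
  exact: sat_shift (hL _ al ad) (trunc_nat_eq p_prime L y).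
move=> y e; split=> [h _ /mapP[a al ->]|h a al].
  by apply/(satE _ _ _ al); exact: h.
by apply/(satE _ _ _ al); apply: h; exact: (map_f (fun a : atom Zp => nat_atom a _)).
Qed.

Local Open Scope classical_set_scope.

(** Only disjoint unions and differences of nested sets occur, the operations through which an
    additive invariant can be followed. *)
Lemma definable_ind n (P : set 'rV[M]_n -> Prop) :
  (forall l, P [set v | basic l (env v)]) ->
  (forall A B, A `&` B = set0 -> P A -> P B -> P (A `|` B)) ->
  (forall A B, B `<=` A -> P A -> P B -> P (A `\` B)) ->
  forall A, definable A -> P A.
Proof.
move=> Pb PU PD A [f hf]; have [l hl] := formula_determined p_prime f.
have P0 : P set0 by rewrite -(setDv [set v | basic [::] (env v)]); exact: PD.
(* The list l0 accumulates the atoms already required to hold, while l holds those still to be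
   decided. *)
suff H : forall l (S : set 'rV[M]_n) l0,
    (forall v v', same_type l (env v) (env v') -> S v -> S v') ->
    P ([set v | basic l0 (env v)] `&` S).
  rewrite (_ : A = [set v | basic [::] (env v)] `&` A); last first.
    by apply/seteqP; split=> v; [split|case].
  apply: (H l) => v v' same /hf Av; apply/hf; exact: hl Av.
elim=> [|a l' IH] S l0 hS.
  case: (pselect (exists v, S v)) => [[v Sv]|nS].
    rewrite (_ : _ `&` _ = [set v | basic l0 (env v)]) //.
    by apply/seteqP; split=> w; [case|split=> //; exact: hS Sv].
  rewrite (_ : _ `&` _ = set0) //.
  by apply/seteqP; split=> // w [_ Sw]; apply: nS; exists w.
(* [T b] agrees with S where the truth value of a is b, and is extended elsewhere so as to depend on
   l' alone. *)
pose T (b : Prop) : set 'rV[M]_n := [set v | exists v',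
  [/\ same_type l' (env v') (env v), sat (env v') a <-> b & S v']].
have hT b v v' : same_type l' (env v) (env v') -> T b v -> T b v'.
  move=> same [w [same' wb Sw]]; exists w; split=> // c cl.
  by rewrite (same' _ cl); exact: same.
have TS b v : (sat (env v) a <-> b) -> T b v <-> S v.
  move=> vb; split=> [[w [same wb]]|Sv]; last by exists v; split.
  apply: hS => c; rewrite inE => /orP[/eqP->|/same //].
  by rewrite wb vb.
(* The part of S where a fails is written as a difference, so that atoms are only ever required to
   hold. *)
have -> : [set v | basic l0 (env v)] `&` S =
    ([set v | basic (a :: l0) (env v)] `&` T True) `|`
    (([set v | basic l0 (env v)] `&` T False) `\`
     ([set v | basic (a :: l0) (env v)] `&` T False)).
  apply/seteqP; split=> v.
    move=> [bv Sv]; case: (pselect (sat (env v) a)) => av.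
      by left; split; [exact/basic_cons|exact/TS].
    right; split; first by split=> //; apply/TS.
    by move=> [/basic_cons[]].
  move=> [[/basic_cons[av bv] tv]|[[bv tv] nv]]; split=> //; first exact/(TS True).
  have av : ~ sat (env v) a by move=> av; apply: nv; split=> //; exact/basic_cons.
  exact/(TS False).
apply: PU.
- apply/seteqP; split=> // v [[/basic_cons[av bv] tv] [[bv' tv'] nv]].
  by apply: nv; split=> //; apply/basic_cons.
- by apply: IH; exact: hT.
- apply: PD; [|by apply: IH; exact: hT|by apply: IH; exact: hT].
  by move=> v [/basic_cons[_ bv] tv].
Qed.

Lemma definable_basic n l : definable [set v : 'rV[M]_n | basic l (env v)].
Proof.
elim: l => [|a l IH].
  by apply: (@definable_ext _ _ _ (fun=> True)) (dcst _ _ _) => v; split.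
apply: (@definable_ext _ _ _ (fun v : 'rV[M]_n => sat (env v) a /\ basic l (env v))).
  by move=> v; rewrite /= basic_cons.
apply: dand IH.
exists (Ex (Equal (tsubst (fun i => Var i.+1) a.2) (Act (Var 0) a.1))) => v /=.
by split=> -[z h]; exists z; move: h; rewrite Defs.eval_tsubst.
Qed.

End BasicSets.

(** * Integration on the line *)

Lemma sum_modn (T : nmodType) (c : nat -> T) m k :
  \sum_(0 <= i < m * k) c (i %% k)%N = (\sum_(0 <= i < k) c i) *+ m.
Proof.
elim: m => [|m IH]; first by rewrite mul0n big_geq.
rewrite mulSnr (@big_cat_nat _ _ _ (m * k)) ?leq_addr //= IH mulrSr; congr (_ + _).
rewrite -[X in \sum_(X <= _ < _) _](add0n (m * k)%N) big_addn addKn.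
rewrite !big_mkord; apply: eq_bigr => i _.
by rewrite addnC modnMDl modn_small.
Qed.

Section Integral.
Variables (p : nat) (T : comNzRingType) (X : T).
Hypotheses (p_prime : prime p) (XE : X *+ p = X).
Local Notation Zp := (padic_int p).
Local Notation M := (right_regular Zp).
Local Notation q L := ((p ^ L)%N%:R : Zp).
Implicit Types (g h : Zp -> T) (s : seq (Zp * T)) (c : nat -> T).

Lemma X_expp L : X *+ p ^ L = X.
Proof. by elim: L => [|L IH]; rewrite ?mulr1n // expnS mulrnA XE. Qed.

(** Point masses plus a function of the residue modulo p^L. Points may repeat in s, so that sums are
    formed by concatenation. *)
Definition represents g s L c :=
  forall y, g y = \sum_(i <- s) i.2 *+ (y == i.1) + c (trunc L y).

(* Points have volume 1 and Zp has volume X; hence each of the p^L cosets of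
   p^L Zp also has volume X. *)
Definition has_integral g v := exists s L c, represents g s L c /\
  v = \sum_(i <- s) i.2 + X * \sum_(0 <= r < p ^ L) c r.

(** Passing to a finer modulus repeats each value p^(N-L) times, and X absorbs this factor. *)
Lemma represents_refine g s L c N : (L <= N)%N -> represents g s L c ->
  exists2 c', represents g s N c' &
    X * \sum_(0 <= r < p ^ N) c' r = X * \sum_(0 <= r < p ^ L) c r.
Proof.
move=> LN h; exists (fun r => c (r %% p ^ L)%N).
  by move=> y; rewrite h (trunc_mod p_prime _ LN).
by rewrite -(subnK LN) expnD sum_modn mulrnAr -mulrnAl X_expp.
Qed.

(** The total weight is the sum of the values of the function over the distinct points of both
    lists. *)
Lemma sum_points_inj s s' :
  (forall y, \sum_(i <- s) i.2 *+ (y == i.1) = \sum_(i <- s') i.2 *+ (y == i.1)) ->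
  \sum_(i <- s) i.2 = \sum_(i <- s') i.2.
Proof.
move=> h; pose u := undup ([seq i.1 | i <- s] ++ [seq i.1 | i <- s']).
have E s0 : {subset [seq i.1 | i <- s0] <= u} ->
    \sum_(i <- s0) i.2 = \sum_(y <- u) \sum_(i <- s0) i.2 *+ (y == i.1).
  move=> sub; rewrite exchange_big /=; apply: eq_big_seq => i /(map_f fst)/sub iu.
  rewrite (bigD1_seq i.1) ?undup_uniq //= eqxx big1 ?addr0 // => y /negbTE ->.
  exact: mulr0n.
rewrite !E; first by apply: eq_bigr => y _; exact: h.
  by move=> y ys; rewrite mem_undup mem_cat ys orbT.
by move=> y ys; rewrite mem_undup mem_cat ys.
Qed.

(** Over a common modulus the residue parts agree, because every coset contains a point off both
    lists; then the point parts agree too. *)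
Lemma has_integral_fun g v w : has_integral g v -> has_integral g w -> v = w.
Proof.
move=> [s [L [c [hg ->]]]] [s' [L' [c' [hg' ->]]]].
have [d hd <-] := represents_refine (leq_maxl L L') hg.
have [d' hd' <-] := represents_refine (leq_maxr L L') hg'.
set N := maxn L L' in hd hd' *.
have dE r : (r < p ^ N)%N -> d r = d' r.
  move=> rN.
  have [y [yr]] := coset_avoid p_prime ([seq i.1 | i <- s] ++ [seq i.1 | i <- s']) r%:R N.
  rewrite mem_cat negb_or => /andP[ys ys'].
  have yE : trunc N y = r.
    by have /(trunc_eqP p_prime) -> := yr; rewrite trunc_nat // modn_small.
  have z s0 : y \notin [seq i.1 | i <- s0] -> \sum_(i <- s0) i.2 *+ (y == i.1) = 0.
    move=> ys0; rewrite big_seq big1 // => i /(map_f fst) is0.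
    by case: eqP => // e; rewrite -e (negbTE ys0) in is0.
  by have := hd y; rewrite hd' !z // !add0r yE.
congr (_ + X * _); last by rewrite !big_mkord; apply: eq_bigr => r _; exact: dE.
apply: sum_points_inj => y; have := hd y; rewrite hd' dE ?trunc_lt //.
by move=> /addIr.
Qed.

Lemma has_integral_ext g h v : g =1 h -> has_integral g v -> has_integral h v.
Proof. by move=> /funext ->. Qed.

Lemma has_integralD g h v w : has_integral g v -> has_integral h w ->
  has_integral (fun y => g y + h y) (v + w).
Proof.
move=> [s [L [c [hg ->]]]] [s' [L' [c' [hg' ->]]]].
have [d hd <-] := represents_refine (leq_maxl L L') hg.
have [d' hd' <-] := represents_refine (leq_maxr L L') hg'.
exists (s ++ s'), (maxn L L'), (fun r => d r + d' r); split.
  by move=> y; rewrite hd hd' big_cat addrACA.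
by rewrite big_cat big_split mulrDr addrACA.
Qed.

Lemma has_integralZ g v (k : T) : has_integral g v ->
  has_integral (fun y => k * g y) (k * v).
Proof.
move=> [s [L [c [hg ->]]]].
exists [seq (i.1, k * i.2) | i <- s], L, (fun r => k * c r); split.
  move=> y; rewrite hg mulrDr big_map mulr_sumr; congr (_ + _).
  by apply: eq_bigr => i _; rewrite mulrnAr.
by rewrite big_map mulrDr mulrCA !mulr_sumr.
Qed.

Lemma has_integral0 : has_integral (fun=> 0) 0.
Proof.
by exists [::], 0%N, (fun=> 0); split=> [y|]; rewrite big_nil ?add0r // big1 ?mulr0.
Qed.

Lemma has_integral_point (a : Zp) : has_integral (fun y => (y == a)%:R) 1.
Proof.
exists [:: (a, 1)], 0%N, (fun=> 0); split=> [y|]; first by rewrite big_seq1 addr0.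
by rewrite big_seq1 big1 ?mulr0 ?addr0.
Qed.

Lemma has_integral_trunc L c :
  has_integral (fun y => c (trunc L y)) (X * \sum_(0 <= r < p ^ L) c r).
Proof.
by exists [::], L, c; split=> [y|]; rewrite big_nil add0r.
Qed.

Lemma has_integral_trunc_eq L r : (r < p ^ L)%N ->
  has_integral (fun y : Zp => (trunc L y == r)%:R) X.
Proof.
move=> rL; have := has_integral_trunc L (fun k => (k == r)%:R).
rewrite big_mkord (bigD1 (Ordinal rL)) //= eqxx big1 ?addr0 ?mulr1 //.
by move=> i /negbTE h; case: eqP => // e; case/eqP: h; exact: val_inj.
Qed.

Lemma has_integral_coset (d z : Zp) : d <> 0 ->
  has_integral (fun y => (`[< divides d (y - z) >])%:R) X.
Proof.
move=> /(padic_factor p_prime)[L [u [w [-> uw]]]].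
apply: has_integral_ext (has_integral_trunc_eq (trunc_lt p_prime L z)) => y.
congr (nat_of_bool _)%:R; apply/eqP/asboolP; rewrite (trunc_eqP p_prime).
  by move=> [k ->]; exists (k * w); rewrite -[LHS]mulr1 -uw; ring.
by move=> [k ->]; exists (k * u); ring.
Qed.

(** Total, so that integrals can be iterated without carrying proofs of integrability. *)
Definition chi1 g : T := xget 0 (has_integral g).

Lemma chi1E g v : has_integral g v -> chi1 g = v.
Proof.
rewrite /chi1; case: xgetP => [w _ hw hv|/(_ v)//].
exact: has_integral_fun hw hv.
Qed.

End Integral.

(** * Tame functions and their integral in every dimension *)

Section Tame.
Variables (p : nat) (T : comNzRingType) (X : T).
Hypotheses (p_prime : prime p) (XE : X *+ p = X).
Local Notation Zp := (padic_int p).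
Local Notation M := (right_regular Zp).
Local Notation q L := ((p ^ L)%N%:R : Zp).
Implicit Types (l : seq (atom Zp)) (e : nat -> M).
Local Notation chi1 := (chi1 X).
Local Notation has_integral := (has_integral X).
Local Notation chi1E := (chi1E p_prime XE).

Definition indic l e : T := (`[< basic l e >])%:R.

Definition tame n (F : 'rV[M]_n -> T) :=
  exists s : seq (T * seq (atom Zp)),
    forall v, F v = \sum_(i <- s) i.1 * indic i.2 (env v).

Lemma tame_ind n (P : ('rV[M]_n -> T) -> Prop) :
  P (fun=> 0) ->
  (forall c l F, tame F -> P F -> P (fun v => c * indic l (env v) + F v)) ->
  forall F, tame F -> P F.
Proof.
move=> P0 PD F [s /funext ->].
elim: s => [|[c l] s IH].
  by rewrite (_ : (fun v => _) = (fun=> 0)) //; apply/funext => v; rewrite big_nil.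
rewrite (_ : (fun v => _) = fun v =>
    c * indic l (env v) + \sum_(i <- s) i.1 * indic i.2 (env v)).
  by apply: PD => //; exists s.
by apply/funext => v; rewrite big_cons.
Qed.

Lemma tame_ext n (F G : 'rV[M]_n -> T) : F =1 G -> tame F -> tame G.
Proof. by move=> /funext ->. Qed.

Lemma tame0 n : tame (fun _ : 'rV[M]_n => 0).
Proof. by exists [::] => v; rewrite big_nil. Qed.

Lemma tame_indic n l : tame (fun v : 'rV[M]_n => indic l (env v)).
Proof. by exists [:: (1, l)] => v; rewrite big_seq1 mul1r. Qed.

Lemma tameD n (F G : 'rV[M]_n -> T) : tame F -> tame G -> tame (fun v => F v + G v).
Proof. by move=> [s hs] [s' hs']; exists (s ++ s') => v; rewrite hs hs' big_cat. Qed.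

Lemma tameZ n c (F : 'rV[M]_n -> T) : tame F -> tame (fun v => c * F v).
Proof.
move=> [s hs]; exists [seq (c * i.1, i.2) | i <- s] => v.
by rewrite hs big_map mulr_sumr; apply: eq_bigr => i _; rewrite mulrA.
Qed.

Lemma tame_sum n (I : Type) (r : seq I) (F : I -> 'rV[M]_n -> T) :
  (forall i, tame (F i)) -> tame (fun v => \sum_(i <- r) F i v).
Proof.
move=> h; elim: r => [|i r IH].
  by apply: tame_ext (tame0 n) => v; rewrite big_nil.
by apply: tame_ext (tameD (h i) IH) => v; rewrite big_cons.
Qed.

Lemma tame_subst n m (F : 'rV[M]_m -> T) (f : 'rV[M]_n -> 'rV[M]_m) :
  tame F -> tmap f -> tame (fun v => F (f v)).
Proof.
move=> tF [s hs].
pose sub l : seq (atom Zp) := [seq (a.1, tsubst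
  (fun i => if insub i is Some j then s j else Zero) a.2) | a <- l].
have envE v : env (f v) =
    (fun i => eval (env v) (if insub i is Some j then s j else Zero)).
  by apply/funext => i; rewrite /env; case: insubP => //= j _ _; rewrite hs.
move: F tF; apply: tame_ind => [|c l F _ IH]; first exact: tame0.
apply: tameD IH; apply: tameZ; apply: tame_ext (tame_indic n (sub l)) => v.
have satE (a : atom Zp) : sat (env (f v)) a <-> sat (env v) (a.1, tsubst
  (fun i => if insub i is Some j then s j else Zero) a.2).
  by rewrite envE /sat Defs.eval_tsubst.
congr (nat_of_bool _)%:R; apply/asboolP/asboolP => [h a al|h _ /mapP[a al ->]].
  by apply/satE; apply: h; exact: (map_f (fun a : atom Zp => (_, _))).
by apply/satE; exact: h.
Qed.

(** By linearity it suffices to treat one indicator. Over the remaining coordinates it integrates to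
    the indicator of l' if the set is a graph, and otherwise to X times a sum of indicators over the
    residues. *)
Lemma tame_integral n (F : 'rV[M]_n.+1 -> T) : tame F ->
  (forall v, exists w, has_integral (fun y => F (vcons y v)) w) /\
  tame (fun v => chi1 (fun y => F (vcons y v))).
Proof.
move: F; apply: tame_ind => [|c l F _ [IHi IHt]].
  split=> [v|]; first by exists 0; exact: has_integral0.
  apply: tame_ext (tame0 n) => v; rewrite (@chi1E _ 0) //; exact: has_integral0.
suff [G tG hG] : exists2 G, tame G &
    forall v : 'rV[M]_n, has_integral (fun y => indic l (env (vcons y v))) (G v).
  have hI v : has_integral (fun y => c * indic l (env (vcons y v)) + F (vcons y v))
      (c * G v + chi1 (fun y => F (vcons y v))).
    apply: has_integralD => //; first exact: has_integralZ.
    by have [w hw] := IHi v; rewrite (chi1E hw).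
  split=> [v|]; first by exists (c * G v + chi1 (fun y => F (vcons y v))).
  apply: tame_ext (tameD (tameZ c tG) IHt) => v.
  by rewrite (chi1E (hI v)).
have [[a [t [l' [a0 l'P lP]]]]|[L [l_ lP]]] := basic_scons p_prime l.
  exists (fun v : 'rV[M]_n => indic l' (env v)) => [|v]; first exact: tame_indic.
  rewrite /indic; case: (pselect (basic l' (env v))) => [h|h]; last first.
    rewrite (asboolF h) [_%:R]mulr0n.
    apply: has_integral_ext (@has_integral0 p T X) => y.
    by rewrite env_vcons asboolF // => /lP[].
  rewrite (asboolT h) [_%:R]mulr1n; have [z hz] := l'P _ h.
  apply: has_integral_ext (has_integral_point X (- z)) => y.
  congr (nat_of_bool _)%:R; rewrite env_vcons; apply/eqP/asboolP => [->|/lP[_]].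
    by apply/lP; split=> //; rewrite hz; ring.
  rewrite hz => e; apply: (padic_mulI p_prime a0).
  by rewrite -[RHS]addr0 -e; ring.
exists (fun v : 'rV[M]_n => X * \sum_(0 <= r < p ^ L) indic (l_ r) (env v)) => [|v].
  by apply: tameZ; apply: tame_sum => r; exact: tame_indic.
apply: has_integral_ext (@has_integral_trunc p T X L (fun r => indic (l_ r) (env v))) => y.
by rewrite env_vcons; congr (nat_of_bool _)%:R; apply/asboolP/asboolP => /lP.
Qed.

(** Coordinate 0 is integrated first; the other order of integration is the subject of Fubini's
    theorem. *)
Fixpoint chi n : ('rV[M]_n -> T) -> T :=
  match n with
  | 0 => fun F => F 0
  | n.+1 => fun F => chi (fun v => chi1 (fun y => F (vcons y v)))
  end.

Lemma chiD n (F G : 'rV[M]_n -> T) : tame F -> tame G ->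
  chi (fun v => F v + G v) = chi F + chi G.
Proof.
elim: n F G => //= n IH F G tF tG.
have [hF tF'] := tame_integral tF; have [hG tG'] := tame_integral tG.
rewrite -IH //; congr chi; apply/funext => v.
have [w hw] := hF v; have [w' hw'] := hG v.
by rewrite (chi1E hw) (chi1E hw'); apply: chi1E; exact: has_integralD.
Qed.

Lemma chiZ n c (F : 'rV[M]_n -> T) : tame F -> chi (fun v => c * F v) = c * chi F.
Proof.
elim: n F => //= n IH F tF; have [hF tF'] := tame_integral tF.
rewrite -IH //; congr chi; apply/funext => v; have [w hw] := hF v.
by rewrite (chi1E hw); apply: chi1E; exact: has_integralZ.
Qed.

Lemma chi0 n : chi (fun _ : 'rV[M]_n => 0) = 0.
Proof.
rewrite -[RHS](mul0r (chi (fun _ : 'rV[M]_n => 0))) -chiZ; last exact: tame0.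
by congr chi; apply/funext => v; rewrite mul0r.
Qed.

Lemma chi_cst n : chi (fun _ : 'rV[M]_n => 1) = X ^+ n.
Proof.
elim: n => [|n IH]; first by rewrite expr0.
transitivity (chi (fun _ : 'rV[M]_n => X * 1)).
  rewrite [LHS]/=; congr chi; apply/funext => v; apply: chi1E.
  have := @has_integral_trunc p T X 0 (fun=> 1).
  by rewrite expn0 big_nat1.
rewrite chiZ ?IH ?exprS //; apply: tame_ext (tame_indic n [::]) => v.
by rewrite /indic asboolT.
Qed.

Lemma chi_point n (a : 'rV[M]_n) : chi (fun v => (v == a)%:R) = 1.
Proof.
elim: n a => [|n IH] a /=.
  by rewrite (_ : (0 == a) = true) //; apply/eqP/rowP => -[].
rewrite -[RHS](IH (vtail a)); congr chi; apply/funext => v; apply: chi1E.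
have E (y : Zp) : (vcons y v == a) = (v == vtail a) && (y == (a 0 0 : Zp)).
  apply/eqP/andP => [<-|[/eqP-> /eqP->]]; last exact: vconsK.
  by rewrite vtailK vcons0 !eqxx.
case: (v == vtail a) E => E.
  by apply: has_integral_ext (has_integral_point X (a 0 0 : Zp)) => y; rewrite E.
by apply: has_integral_ext (@has_integral0 p T X) => y; rewrite E.
Qed.

(** No exchange of integrals takes place: [chi] already integrates the coordinates of u before those
    of v. *)
Lemma chi_row n m (F : 'rV[M]_(n + m) -> T) :
  chi F = chi (fun v : 'rV[M]_m => chi (fun u : 'rV[M]_n => F (row_mx u v))).
Proof.
elim: n F => [|n IH] F.
  congr (@chi m); apply/funext => v /=; congr F; apply/rowP => i.
  have -> : i = rshift 0 i by exact: val_inj.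
  by rewrite row_mxEr; congr (v _ _); exact: val_inj.
rewrite [LHS]/= IH; congr chi; apply/funext => v; congr chi; apply/funext => u.
by congr chi1; apply/funext => y; rewrite vcons_row.
Qed.

End Tame.

(** * Fubini's theorem and the volume *)

Section Fubini.
Variables (p : nat) (T : comNzRingType) (X : T).
Hypotheses (p_prime : prime p) (XE : X *+ p = X).
Local Notation Zp := (padic_int p).
Local Notation M := (right_regular Zp).
Local Notation q L := ((p ^ L)%N%:R : Zp).
Implicit Types (l : seq (atom Zp)) (e : nat -> M).
Local Notation chi1 := (chi1 X).
Local Notation chi := (chi X).
Local Notation has_integral := (has_integral X).
Local Notation chi1E := (chi1E p_prime XE).
Local Notation indic := (indic T).

(** Existence of both iterated integrals and their equality are bundled, so that they pass together
    through linear combinations. *)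
Definition iterated_integrals (F : Zp -> Zp -> T) w :=
  (exists2 G, forall y, has_integral (F^~ y) (G y) & has_integral G w) /\
  (exists2 H, forall z, has_integral (F z) (H z) & has_integral H w).

Lemma iterated_integrals_ext (F F' : Zp -> Zp -> T) w :
  (forall z y, F z y = F' z y) -> iterated_integrals F w -> iterated_integrals F' w.
Proof.
by move=> h; rewrite (_ : F' = F) //; apply/funext => z; apply/funext => y.
Qed.

Lemma iterated_integralsD (F F' : Zp -> Zp -> T) w w' :
  iterated_integrals F w -> iterated_integrals F' w' ->
  iterated_integrals (fun z y => F z y + F' z y) (w + w').
Proof.
move=> [[G hG Gw] [H hH Hw]] [[G' hG' Gw'] [H' hH' Hw']]; split.
  by exists (fun y => G y + G' y) => [y|]; exact: has_integralD.
by exists (fun z => H z + H' z) => [z|]; exact: has_integralD.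
Qed.

Lemma iterated_integralsZ k (F : Zp -> Zp -> T) w :
  iterated_integrals F w -> iterated_integrals (fun z y => k * F z y) (k * w).
Proof.
move=> [[G hG Gw] [H hH Hw]]; split.
  by exists (fun y => k * G y) => [y|]; exact: has_integralZ.
by exists (fun z => k * H z) => [z|]; exact: has_integralZ.
Qed.

Lemma iterated_integrals0 : iterated_integrals (fun _ _ => 0) 0.
Proof. by split; exists (fun=> 0) => *; exact: has_integral0. Qed.

Lemma iterated_integrals_sum (I : Type) (s : seq I) (F : I -> Zp -> Zp -> T) w :
  (forall r, iterated_integrals (F r) (w r)) ->
  iterated_integrals (fun z y => \sum_(r <- s) F r z y) (\sum_(r <- s) w r).
Proof.
move=> h; elim: s => [|r s IH].
  rewrite big_nil; apply: iterated_integrals_ext iterated_integrals0 => z y.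
  by rewrite big_nil.
rewrite big_cons; apply: iterated_integrals_ext (iterated_integralsD (h r) IH) => z y.
by rewrite big_cons.
Qed.

Lemma iterated_integrals_prod (g h : Zp -> T) v w :
  has_integral g v -> has_integral h w ->
  iterated_integrals (fun z y => g z * h y) (v * w).
Proof.
move=> hg hh; split.
  exists (fun y => v * h y) => [y|]; last exact: has_integralZ.
  rewrite mulrC; apply: has_integral_ext (has_integralZ (h y) hg) => z.
  exact: mulrC.
exists (fun z => g z * w) => [z|]; first exact: has_integralZ.
rewrite mulrC; apply: has_integral_ext (has_integralZ w hg) => z.
exact: mulrC.
Qed.

Lemma indic_point (a c z : Zp) : a <> 0 -> c = z * a ->
  forall y, `[< a * y + c = 0 >] = (y == - z).
Proof.
move=> a0 -> y; apply/asboolP/eqP => [e|->]; last by ring.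
by apply: (padic_mulI p_prime a0); rewrite -[RHS]addr0 -e; ring.
Qed.

(** Each y congruent to r has exactly one z on the line, so integrating z first gives X. For b = 0
    the segment is a point times a coset. Otherwise it projects bijectively onto a coset in z, again
    of volume X. *)
Lemma iterated_integrals_segment (a b c : Zp) L r : (r < p ^ L)%N -> a <> 0 ->
  (forall y, trunc L y = r -> divides a (b * y + c)) ->
  iterated_integrals
    (fun z y => (trunc L y == r)%:R * (`[< a * z + (b * y + c) = 0 >])%:R) X.
Proof.
move=> rL a0 ha.
have tr : trunc L (r%:R : Zp) = r by rewrite trunc_nat // modn_small.
case: (pselect (b = 0)) => [b0|b0].
  have [z0 hz0] : divides a c by have := ha _ tr; rewrite b0 mul0r add0r.
  apply: (@iterated_integrals_ext (fun z y => (z == - z0)%:R * (trunc L y == r)%:R)).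
    by move=> z y; rewrite b0 mul0r add0r (indic_point a0 hz0) mulrC.
  rewrite -[X in iterated_integrals _ X]mul1r.
  apply: iterated_integrals_prod; first exact: has_integral_point.
  exact: has_integral_trunc_eq.
split.
  exists (fun y => (trunc L y == r)%:R) => [y|]; last exact: has_integral_trunc_eq.
  case: eqP => [e|_]; last first.
    rewrite [_%:R]mulr0n; apply: has_integral_ext (@has_integral0 p T X) => z.
    by rewrite mul0r.
  have [z0 hz0] := ha _ e; rewrite [_%:R]mulr1n.
  apply: has_integral_ext (has_integral_point X (- z0)) => z.
  by rewrite mul1r (indic_point a0 hz0).
have [z0 hz0] := ha _ tr.
(* Along the segment, adding p^L to y subtracts b' from z; hence z runs through the coset of - z0
   modulo b'. *)
have [b' hb'] : divides a (b * q L).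
  have -> : b * q L = (b * (r%:R + q L) + c) + - 1 * (b * r%:R + c) by ring.
  apply: dividesD; last by apply: dividesMl; exact: ha.
  apply: ha; rewrite -[RHS]tr; apply/(trunc_eqP p_prime).
  by exists 1; ring.
have b'0 : b' <> 0.
  move=> e; move: hb'; rewrite e mul0r => /(padic_mul_eq0 p_prime)[//|].
  exact: q_neq0.
exists (fun z => (`[< divides b' (z - - z0) >])%:R); last exact: has_integral_coset.
move=> z; case: (asboolP (divides b' (z - - z0))) => [[w hw]|nd].
  rewrite [_%:R]mulr1n.
  apply: has_integral_ext (has_integral_point X (r%:R - w * q L)) => y.
  have zE : z = w * b' - z0 by rewrite -hw; ring.
  have eE : a * z + (b * y + c) = b * (y - (r%:R - w * q L)).
    transitivity (a * z + b * (y - r%:R) + (b * r%:R + c)); first by ring.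
    rewrite hz0 zE; transitivity (w * (b' * a) + b * (y - r%:R)); first by ring.
    by rewrite -hb'; ring.
  rewrite eE -natrM mulnb; congr (nat_of_bool _)%:R.
  apply/eqP/andP => [->|[_ /asboolP/(padic_mul_eq0 p_prime)[//|/eqP]]].
    split; last by apply/asboolP; rewrite subrr mulr0.
    apply/eqP; rewrite -[RHS]tr; apply/(trunc_eqP p_prime); exists (- w); ring.
  by rewrite subr_eq0 => /eqP.
rewrite [_%:R]mulr0n; apply: has_integral_ext (@has_integral0 p T X) => y.
rewrite -natrM mulnb [X in nat_of_bool X](_ : _ = false) //.
apply/negP => /andP[/eqP yr /asboolP e]; apply: nd.
have /(trunc_eqP p_prime)[w hw] : trunc L y = trunc L (r%:R : Zp) by rewrite tr.
exists (- w); apply: (padic_mulI p_prime a0).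
have yE : y = w * q L + r%:R by rewrite -hw; ring.
have -> : a * (- w * b') = - w * (b * q L) by rewrite hb'; ring.
have -> : a * (z - - z0) = a * z + (b * r%:R + c) by rewrite hz0; ring.
rewrite -[RHS]addr0 -e yE; ring.
Qed.

(** Apply [basic_scons] to z, then to y if z is determined. The set is cut into products, a single
    point, or segments of a line over residue classes of y. *)
Lemma iterated_integrals_indic n l (v : 'rV[M]_n) :
  exists w, iterated_integrals (fun z y => indic l (env (vcons z (vcons y v)))) w.
Proof.
set e0 := env v.
suff [w hw] : exists w, iterated_integrals (fun z y =>
    indic l (scons (z : M) (scons (y : M) e0))) w.
  by exists w; apply: iterated_integrals_ext hw => z y; rewrite !env_vcons.
have cellE (P Q : Prop) : (`[< P /\ Q >])%:R = (`[< P >])%:R * (`[< Q >])%:R :> T.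
  by rewrite asbool_and -natrM mulnb.
have [[a [t [l' [a0 l'P lP]]]]|[L [l_ lP]]] := basic_scons p_prime l; last first.
  have /choice[w hw] (r : 'I_(p ^ L)) :
      exists w, has_integral (fun y => indic (l_ r) (scons (y : M) e0)) w.
    have [+ _] := tame_integral p_prime XE (@tame_indic p T n.+1 (l_ r)).
    by move=> /(_ v)[w hw]; exists w; apply: has_integral_ext hw => y; rewrite env_vcons.
  exists (\sum_(r < p ^ L) X * w r).
  apply: (@iterated_integrals_ext (fun z y => \sum_(r < p ^ L)
     (trunc L z == r)%:R * indic (l_ r) (scons (y : M) e0))).
    move=> z y; rewrite (bigD1 (Ordinal (trunc_lt p_prime L z))) //= eqxx mul1r.
    rewrite big1 ?addr0 => [|i /negbTE ne]; last first.
      by case: eqP => [e|_]; [case/eqP: ne; exact: val_inj|rewrite mul0r].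
    by congr (nat_of_bool _)%:R; apply/asboolP/asboolP => /lP.
  apply: iterated_integrals_sum => r; apply: iterated_integrals_prod (hw r).
  exact: has_integral_trunc_eq.
pose b := coef0 t; pose c : Zp := eval e0 (tail t).
have FE z y : indic l (scons (z : M) (scons (y : M) e0)) =
    indic l' (scons (y : M) e0) * (`[< a * z + (b * y + c) = 0 >])%:R.
  rewrite -cellE; congr (nat_of_bool _)%:R; apply/asboolP/asboolP => [/lP[h]|[h h']].
    by rewrite eval_scons.
  by apply/lP; rewrite eval_scons.
have dv (y : Zp) : basic l' (scons (y : M) e0) -> divides a (b * y + c).
  by move=> /l'P; rewrite eval_scons.
have [[a' [t' [l'' [a'0 l''P l'E]]]]|[L [l_ l'E]]] := basic_scons p_prime l'.
  case: (pselect (basic l'' e0)) => [h|h]; last first.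
    exists 0; apply: iterated_integrals_ext iterated_integrals0 => z y.
    by rewrite FE {1}/indic asboolF ?mul0r // => /l'E[].
  have [y0 hy0] := l''P _ h.
  have y0P : basic l' (scons ((- y0 : Zp) : M) e0).
    by apply/l'E; split=> //; rewrite hy0; ring.
  (* Both coordinates are determined: the set is the single point with z = - z0 and y = - y0. *)
  have [z0 hz0] := dv _ y0P; exists (1 * 1).
  apply: iterated_integrals_ext (iterated_integrals_prod
    (has_integral_point X (- z0)) (has_integral_point X (- y0))) => z y.
  rewrite FE mulrC; case: eqP => [->|ne].
    by rewrite (indic_point a0 hz0) /indic asboolT.
  rewrite !mul0r {1}/indic asboolF ?mul0r // => /l'E[_ e]; apply: ne.
  by apply/eqP; rewrite -(indic_point a'0 hy0); exact/asboolP.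
exists (\sum_(r < p ^ L) indic (l_ r) e0 * X).
apply: (@iterated_integrals_ext (fun z y => \sum_(r < p ^ L) indic (l_ r) e0 *
   ((trunc L y == r)%:R * (`[< a * z + (b * y + c) = 0 >])%:R))).
  move=> z y; rewrite FE (bigD1 (Ordinal (trunc_lt p_prime L y))) //= eqxx mul1r.
  rewrite big1 ?addr0 => [|i /negbTE ne]; last first.
    by case: eqP => [e|_]; [case/eqP: ne; exact: val_inj|rewrite mul0r mulr0].
  by congr ((nat_of_bool _)%:R * _); apply/asboolP/asboolP => /l'E.
apply: iterated_integrals_sum => r.
case: (pselect (basic (l_ r) e0)) => [h|h]; last first.
  rewrite /indic asboolF // mul0r.
  by apply: iterated_integrals_ext iterated_integrals0 => z y; rewrite mul0r.
apply: iterated_integralsZ; apply: iterated_integrals_segment => // y yr.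
by apply: dv; apply/l'E; rewrite yr.
Qed.

Lemma tame_iterated n (F : 'rV[M]_n.+2 -> T) v : tame F ->
  exists w, iterated_integrals (fun z y => F (vcons z (vcons y v))) w.
Proof.
move: F; apply: tame_ind => [|c l F _ [w hw]].
  by exists 0; exact: iterated_integrals0.
have [w' hw'] := iterated_integrals_indic l v; exists (c * w' + w).
by apply: iterated_integralsD hw; exact: iterated_integralsZ.
Qed.

Lemma chi1_swap n (F : 'rV[M]_n.+2 -> T) v : tame F ->
  chi1 (fun y => chi1 (fun z => F (vcons z (vcons y v)))) =
  chi1 (fun z => chi1 (fun y => F (vcons z (vcons y v)))).
Proof.
move=> /(tame_iterated v)[w [[G hG Gw] [H hH Hw]]]; transitivity w.
  by apply: chi1E; apply: has_integral_ext Gw => y; rewrite (chi1E (hG y)).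
by symmetry; apply: chi1E; apply: has_integral_ext Hw => z; rewrite (chi1E (hH z)).
Qed.

(** The outermost integral in y moves inward past the coordinates of v, one exchange of two line
    integrals at a time. *)
Lemma chi1_chi m (F : Zp -> 'rV[M]_m -> T) :
  tame (fun w : 'rV[M]_m.+1 => F (w 0 0) (vtail w)) ->
  chi1 (fun y => chi (F y)) = chi (fun v => chi1 (F^~ v)).
Proof.
elim: m F => [//|m IH] F tF /=.
have ti n := @tmap_id _ M n.
(* The same function with its first two coordinates exchanged, to have z in front of y. *)
have t1 : tame (fun w : 'rV[M]_m.+2 =>
    F (vtail w 0 0) (vcons (w 0 0) (vtail (vtail w)))).
  pose f (w : 'rV[M]_m.+2) := vcons (vtail w 0 0) (vcons (w 0 0) (vtail (vtail w))).
  have tf : tmap f.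
    apply: tmap_vcons; first exact: tmap_head (tmap_vtail (ti _)).
    apply: tmap_vcons; first exact: tmap_head (ti _).
    exact: tmap_vtail (tmap_vtail (ti _)).
  by apply: tame_ext (tame_subst tF tf) => w; rewrite /f vcons0 vtailK.
rewrite IH; last first.
  have [_] := tame_integral p_prime XE t1.
  apply: tame_ext => w; congr chi1; apply/funext => z.
  by rewrite vcons0 vtailK.
congr chi; apply/funext => v.
have := chi1_swap v t1.
under eq_fun do under eq_fun do rewrite !(vtailK, vcons0).
move=> ->.
by under eq_fun do under eq_fun do rewrite !(vtailK, vcons0).
Qed.

(** Fubini's theorem, by induction on n: the first coordinate of u moves inside the integral over v
    by [chi1_chi], and the induction hypothesis moves the others. *)
Theorem chi_swap n m (F : 'rV[M]_n -> 'rV[M]_m -> T) :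
  tame (fun w : 'rV[M]_(n + m) => F (lsubmx w) (rsubmx w)) ->
  chi (fun u => chi (F u)) = chi (fun v => chi (F^~ v)).
Proof.
elim: n F => [//|n IH] F tF.
have ti k := @tmap_id _ M k.
have t1 : tame (fun w : 'rV[M]_(n + m).+1 =>
    F (vcons (w 0 0) (lsubmx (vtail w))) (rsubmx (vtail w))).
  pose f (w : 'rV[M]_(n + m).+1) : 'rV[M]_(n.+1 + m) :=
    row_mx (vcons (w 0 0) (lsubmx (vtail w))) (rsubmx (vtail w)).
  have tf : tmap f.
    apply: tmap_row (tmap_r (tmap_vtail (ti _))).
    apply: tmap_vcons; first exact: tmap_head (ti _).
    exact: tmap_l (tmap_vtail (ti _)).
  by apply: tame_ext (tame_subst tF tf) => w; rewrite /f row_mxKl row_mxKr.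
transitivity (chi (fun u => chi (fun v => chi1 (fun y => F (vcons y u) v)))).
  rewrite [LHS]/=; congr chi; apply/funext => u.
  apply: (@chi1_chi _ (fun y v => F (vcons y u) v)).
  pose f (w : 'rV[M]_m.+1) : 'rV[M]_(n + m).+1 := vcons (w 0 0) (row_mx u (vtail w)).
  have tf : tmap f.
    apply: tmap_vcons; first exact: tmap_head (ti _).
    exact: tmap_row (tmap_cst _ u) (tmap_vtail (ti _)).
  apply: tame_ext (tame_subst t1 tf) => w.
  by rewrite /f vcons0 vtailK row_mxKl row_mxKr.
rewrite (IH (fun u v => chi1 (fun y => F (vcons y u) v))) //.
have [_] := tame_integral p_prime XE t1.
apply: tame_ext => w; congr chi1; apply/funext => z.
by rewrite vcons0 vtailK.
Qed.

Local Open Scope classical_set_scope.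

Definition vol n (A : set 'rV[M]_n) : T := chi (fun v => (`[< A v >])%:R).

(** Indicators add on disjoint unions and subtract on differences of nested sets, which are the
    cases of [definable_ind]. *)
Lemma tame_definable n (A : set 'rV[M]_n) :
  definable A -> tame (fun v => (`[< A v >])%:R : T).
Proof.
move: A; apply: (definable_ind p_prime) => [l|A B AB tA tB|A B BA tA tB].
- exact: tame_indic.
- apply: tame_ext (tameD tA tB) => v; rewrite -natrD; congr _%:R.
  case: (asboolP (A v)) => a; case: (asboolP (B v)) => b /=.
  + by have : (A `&` B) v by []; rewrite AB.
  + by rewrite asboolT //; left.
  + by rewrite asboolT //; right.
  + by rewrite asboolF // => -[].
- apply: tame_ext (tameD tA (tameZ (-1) tB)) => v; rewrite mulN1r.
  case: (asboolP (A v)) => a; case: (asboolP (B v)) => b /=.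
  + by rewrite subrr asboolF // => -[].
  + by rewrite subr0 asboolT.
  + by case: a; exact: BA.
  + by rewrite subr0 asboolF // => -[].
Qed.

Lemma volU n (A B : set 'rV[M]_n) : definable A -> definable B ->
  A `&` B = set0 -> vol (A `|` B) = vol A + vol B.
Proof.
move=> dA dB AB; rewrite /vol -chiD //; try exact: tame_definable.
congr chi; apply/funext => v; rewrite -natrD; congr _%:R.
case: (asboolP (A v)) => a; case: (asboolP (B v)) => b /=.
- by have : (A `&` B) v by []; rewrite AB.
- by rewrite asboolT //; left.
- by rewrite asboolT //; right.
- by rewrite asboolF // => -[].
Qed.

Lemma volX n m (A : set 'rV[M]_n) (B : set 'rV[M]_m) :
  definable A -> definable B -> vol (setprod A B) = vol A * vol B.
Proof.
move=> dA dB; transitivity (chi (fun v => vol A * (`[< B v >])%:R)); last first.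
  by rewrite chiZ //; exact: tame_definable.
rewrite /vol chi_row; congr chi; apply/funext => v.
rewrite mulrC -chiZ //; last exact: tame_definable.
congr chi; apply/funext => u; rewrite -natrM mulnb -asbool_and.
congr (nat_of_bool _)%:R; apply/asboolP/asboolP => [[]|[b a]].
  by rewrite row_mxKl row_mxKr.
by split; rewrite ?row_mxKl ?row_mxKr.
Qed.

Lemma vol_point n (A : set 'rV[M]_n) v : (forall w, A w <-> w = v) -> vol A = 1.
Proof.
move=> Av; rewrite -[RHS](chi_point p_prime XE v); congr chi; apply/funext => w.
by congr (nat_of_bool _)%:R; apply/asboolP/eqP => /Av.
Qed.

Lemma vol_set0 n (A : set 'rV[M]_n) : (forall w, ~ A w) -> vol A = 0.
Proof.
move=> Av; rewrite -[RHS](chi0 p_prime XE n); congr chi; apply/funext => w.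
by rewrite asboolF.
Qed.

Lemma vol_setT n : vol [set: 'rV[M]_n] = X ^+ n.
Proof.
rewrite -(chi_cst p_prime XE n); congr chi; apply/funext => w.
by rewrite asboolT.
Qed.

(** The fibres of the graph over A and over B are single points, of volume 1. Integrating its
    indicator in the two orders gives the two volumes. *)
Theorem vol_iso n m (A : set 'rV[M]_n) (B : set 'rV[M]_m) :
  definably_isomorphic A B -> vol A = vol B.
Proof.
move=> /iso_rel[G [dG GAB GA GB Gfun Ginj]].
have := @chi_swap n m (fun u v => (`[< G u v >])%:R) (tame_definable dG).
rewrite (_ : (fun u => _) = fun u => (`[< A u >])%:R); last first.
  apply/funext => u; case: (asboolP (A u)) => [/GA[v Guv]|nA].
    by apply: (@vol_point _ (G u) v) => w; split=> [/(Gfun _ _ _ Guv)|->].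
  by apply: (@vol_set0 _ (G u)) => v /GAB[].
rewrite /vol => ->; congr chi; apply/funext => v.
case: (asboolP (B v)) => [/GB[u Guv]|nB].
  by apply: (@vol_point _ (G^~ v) u) => w; split=> [/(Ginj _ _ _ Guv)|->].
by apply: (@vol_set0 _ (G^~ v)) => u /GAB[].
Qed.

End Fubini.

(** * Generation of K0 by the class of the line *)

Section IntegerPolynomials.
Variables (S : comPzRingType) (x : S).
Implicit Types f g : {poly int}.

(* Not [horner_morph], which requires 1 != 0 in S. *)
Definition zhorner f : S := \sum_(i < size f) x ^+ i *~ f`_i.

Lemma zhornerE N f : (size f <= N)%N -> zhorner f = \sum_(i < N) x ^+ i *~ f`_i.
Proof.
move=> h; rewrite /zhorner (big_ord_widen N (fun i => x ^+ i *~ f`_i)) // [LHS]big_mkcond.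
apply: eq_bigr => i _; case: ltnP => // hi.
by rewrite nth_default ?mulr0z.
Qed.

Lemma zhorner_is_zmod_morphism : zmod_morphism zhorner.
Proof.
move=> f g; pose N := maxn (size f) (size g).
rewrite !(@zhornerE N) ?leq_maxl ?leq_maxr //; last first.
  by rewrite (leq_trans (size_polyD _ _)) // size_polyN.
by rewrite -sumrB; apply: eq_bigr => i _; rewrite coefB mulrzBr.
Qed.

HB.instance Definition _ :=
  GRing.isZmodMorphism.Build {poly int} S zhorner zhorner_is_zmod_morphism.

Lemma zhorner1 : zhorner 1 = 1.
Proof. by rewrite /zhorner size_poly1 big_ord1 expr0 coef1 mulr1z. Qed.

Lemma zhornerMX f : zhorner (f * 'X) = zhorner f * x.
Proof.
rewrite (@zhornerE (size f).+1); last first.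
  by rewrite (leq_trans (size_polyMleq _ _)) // size_polyX addn2.
rewrite big_ord_recl coefMX eqxx mulr0z add0r /zhorner mulr_suml.
by apply: eq_bigr => i _; rewrite coefMX /= exprSr mulrzAl.
Qed.

End IntegerPolynomials.

Section Generation.
Variable p : nat.
Hypothesis p_prime : prime p.
Local Notation Zp := (padic_int p).
Local Notation M := (right_regular Zp).
Local Notation q L := ((p ^ L)%N%:R : Zp).
Implicit Types (l : seq (atom Zp)) (e : nat -> M).
Local Open Scope classical_set_scope.

(* The class of a definable set in K0, which makes sense also for the sets in
   dimension 0 that [defset] excludes. *)
Definition has_class n (A : set 'rV[M]_n) (u : K0 Zp) :=
  exists D : defset M, definably_isomorphic A (points D) /\ u = groth_inj (class D).

Lemma has_class_iso n m (A : set 'rV[M]_n) (B : set 'rV[M]_m) u :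
  definably_isomorphic A B -> has_class B u -> has_class A u.
Proof. by move=> AB [D [BD ->]]; exists D; split=> //; exact: iso_trans AB BD. Qed.

Lemma has_class_fun n (A : set 'rV[M]_n) u v : has_class A u -> has_class A v -> u = v.
Proof.
move=> [D [AD ->]] [D' [AD' ->]]; congr groth_inj; apply/classP.
exact: iso_trans (iso_sym AD) AD'.
Qed.

Lemma has_class_defset (D : defset M) : has_class (points D) (groth_inj (class D)).
Proof. by exists D; split=> //; apply: iso_refl; exact: points_definable. Qed.

(** The product with a point makes the dimension positive without changing the isomorphism type. *)
Lemma has_class_ex n (A : set 'rV[M]_n) : definable A -> exists u, has_class A u.
Proof.
move=> dA.
have d : definable (setprod A (@origin Zp)).
  exact: setprod_definable dA (origin_definable _).
have n0 : (0 < n + 1)%N by rewrite addn1.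
exists (groth_inj (class (DefSet n0 d))), (DefSet n0 d); split=> //.
apply: (@tmap_iso _ _ _ _ _ _ (fun v => row_mx v 0) (fun w => lsubmx w)) => //.
- exact: tmap_row (@tmap_id _ _ _) (tmap_cst _ _).
- by move=> v Av; rewrite row_mxKl; split=> //; split; rewrite ?row_mxKl ?row_mxKr.
- by move=> w [Aw w0]; split=> //; rewrite -[RHS]hsubmxK w0.
Qed.

Lemma has_classU n (A B : set 'rV[M]_n) u v : definable A -> definable B ->
  A `&` B = set0 -> has_class A u -> has_class B v -> has_class (A `|` B) (u + v).
Proof.
move=> dA dB AB [D [AD ->]] [D' [BD' ->]]; exists (defsetD D D'); split.
  exact: iso_trans (setU_iso dA dB AB) (setsum_iso AD BD').
by rewrite -rmorphD -class_addE.
Qed.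

Lemma has_classX n m (A : set 'rV[M]_n) (B : set 'rV[M]_m) u v :
  has_class A u -> has_class B v -> has_class (setprod A B) (u * v).
Proof.
move=> [D [AD ->]] [D' [BD' ->]]; exists (defsetM D D'); split.
  exact: setprod_iso AD BD'.
by rewrite -rmorphM classM.
Qed.

Lemma setT_definable n : definable [set: 'rV[M]_n].
Proof. exact: dcst. Qed.

Definition line : defset M := DefSet (ltn0Sn 0) (@setT_definable 1).

Definition line_class : K0 Zp := groth_inj (class line).

Lemma has_class_set0 n (A : set 'rV[M]_n) : (forall v, ~ A v) -> has_class A 0.
Proof.
move=> A0; exists (defset0 Zp); split; last by rewrite class0 rmorph0.
apply: (@tmap_iso _ _ _ _ _ _ (fun v => 0) (fun v => 0)) => //.
- by apply: (@definable_ext _ _ _ (fun=> False)) (dcst _ _ _) => v; split=> // /A0.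
- exact: tmap_cst.
- by move=> v /A0.
Qed.

Lemma has_class_point n (A : set 'rV[M]_n) a : (forall v, A v <-> v = a) -> has_class A 1.
Proof.
move=> Aa; exists (defset1 Zp); split; last by rewrite class1 rmorph1.
apply: (@tmap_iso _ _ _ _ _ _ (fun v => 0) (fun v => a)) => //.
- apply: (@definable_ext _ _ _ (fun v => v = a)) => [v|]; first by rewrite Aa.
  exact: deq (@tmap_id _ _ _) (tmap_cst _ _).
- exact: tmap_cst.
- by move=> v /Aa ->.
- by move=> v ->; split=> //; apply/Aa.
Qed.

Lemma has_class_sum n (A : set 'rV[M]_n) (phi : 'rV[M]_n -> nat) u N :
  (forall r, (r < N)%N -> definable [set v | A v /\ phi v = r] /\
     has_class [set v | A v /\ phi v = r] (u r)) ->
  has_class [set v | A v /\ (phi v < N)%N] (\sum_(r < N) u r).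
Proof.
(* Definability is carried along because [has_classU] asks for it at each step. *)
move=> h; suff [] : definable [set v | A v /\ (phi v < N)%N] /\
  has_class [set v | A v /\ (phi v < N)%N] (\sum_(r < N) u r) by [].
elim: N h => [|N IH] h.
  split; last by rewrite big_ord0; apply: has_class_set0 => v [].
  by apply: (@definable_ext _ _ _ (fun=> False)) (dcst _ _ _) => v; split=> // -[].
have [dN cN] := IH (fun r rN => h r (ltnW rN)).
have [d c] := h N (ltnSn N).
have -> : [set v | A v /\ (phi v < N.+1)%N] =
    [set v | A v /\ (phi v < N)%N] `|` [set v | A v /\ phi v = N].
  apply/seteqP; split=> v /=; last by case=> -[Av]; [move/ltnW|move=> ->].
  by case=> Av; rewrite ltnS leq_eqVlt => /orP[/eqP|]; [right|left].
split; first exact: dor.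
rewrite big_ord_recr; apply: has_classU => //.
by apply/seteqP; split=> // v [[_ +] [_ vN]]; rewrite /= vN ltnn.
Qed.

Lemma definable_trunc n L r : (r < p ^ L)%N ->
  definable [set w : 'rV[M]_n.+1 | trunc L (w 0 0 : Zp) = r].
Proof.
move=> rL; apply: definable_ext (definable_basic n.+1
  [:: (q L, Add (Var 0) (Opp (Param (r%:R : M))))]) => w /=.
have -> : basic [:: (q L, Add (Var 0) (Opp (Param (r%:R : M))))] (env w) <->
    divides (q L) ((w 0 0 : Zp) - r%:R).
  rewrite -[w 0 0]/(w 0 (0 : 'I_n.+1)) -(env_ord w 0).
  by split=> [/(_ _ (mem_head _ _))|h b]; rewrite // inE => /eqP ->.
by rewrite -(trunc_eqP p_prime) trunc_nat // modn_small.
Qed.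

Lemma tmap_affine n (h : 'rV[M]_n -> Zp) (c d : Zp) :
  tmap (fun v => const_mx (h v : M) : 'rV[M]_1) ->
  tmap (fun v => const_mx (c + h v * d : M) : 'rV[M]_1).
Proof.
move=> [s hs]; exists (fun=> Add (Param (c : M)) (Act (s 0) d)) => v j.
by rewrite mxE /=; have := hs v 0; rewrite mxE => <-.
Qed.

(** The affine map sending z to r + p^L z identifies the line with the coset of r. *)
Lemma has_class_slice n (B : set 'rV[M]_n) L r u :
  (r < p ^ L)%N -> definable B -> has_class B u ->
  has_class [set w : 'rV[M]_n.+1 | B (vtail w) /\ trunc L (w 0 0 : Zp) = r]
    (line_class * u).
Proof.
move=> rL dB cB; apply: has_class_iso (has_classX (has_class_defset line) cB).
apply: iso_sym.
(* The inverse map, division by p^L on the coset. [tmap_iso] asks only the forward map to be given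
   by terms, so a choice function serves here. *)
pose k (y : Zp) : Zp := xget 0 (fun z : Zp => y - r%:R = z * q L).
have kP (y : Zp) : trunc L y = r -> y - r%:R = k y * q L.
  move=> yr; have : divides (q L) (y - r%:R).
    by apply/(trunc_eqP p_prime); rewrite yr trunc_nat // modn_small.
  by move=> [z hz]; rewrite /k; case: xgetP => [//|/(_ z)].
have kE (z : Zp) : k (r%:R + z * q L) = z.
  rewrite /k; case: xgetP => [z' _ h|/(_ z)]; last by case; ring.
  apply: (padic_mulI p_prime (q_neq0 p_prime (L:=L))).
  by rewrite mulrC -h; ring.
apply: (@tmap_iso _ _ _ _ _ _
  (fun w : 'rV[M]_(1 + n) => vcons (r%:R + (lsubmx w 0 0 : Zp) * q L : Zp) (rsubmx w))
  (fun w : 'rV[M]_n.+1 => row_mx (const_mx (k (w 0 0) : M) : 'rV[M]_1) (vtail w))).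
- exact: setprod_definable (@setT_definable 1) dB.
- have ti := @tmap_id _ M (1 + n).
  apply: tmap_vcons (tmap_r ti); apply: tmap_affine.
  exact: (tmap_head (tmap_l ti)).
- move=> w [_ Bw]; rewrite /= vcons0 vtailK kE; split.
    split=> //; rewrite -[RHS](@modn_small r (p ^ L)) // -trunc_nat //.
    by apply/(trunc_eqP p_prime); exists (lsubmx w 0 0 : Zp); ring.
  rewrite -[RHS](@hsubmxK M 1 1 n); congr row_mx; apply/rowP => j.
  by rewrite !mxE (ord1 j).
- move=> w [Bw wr]; split; first by split=> //; rewrite row_mxKr.
  rewrite row_mxKl row_mxKr -[RHS]vconsK; congr vcons; rewrite mxE -kP //; ring.
Qed.

Lemma line_class_mulrn : line_class *+ p = line_class.
Proof.
have cT : has_class [set: 'rV[M]_1] line_class := has_class_defset line.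
apply: (has_class_fun (A := [set: 'rV[M]_1])) => //.
(* Each coset of p Zp is viewed as a slice over dimension 0, whose only point has class 1. *)
have -> : line_class *+ p = \sum_(r < p ^ 1) line_class * 1.
  by rewrite sumr_const card_ord expn1 mulr1.
rewrite (_ : [set: _] = [set w : 'rV[M]_1 | True /\ (trunc 1 (w 0 0 : Zp)%R < p ^ 1)%N]).
  apply: (@has_class_sum 1 [set: 'rV[M]_1] (fun w => trunc 1 (w 0 0 : Zp))
    (fun=> line_class * 1) (p ^ 1)) => r rp; split.
    by apply: definable_ext (definable_trunc 0 rp) => w; split=> // -[].
  have := @has_class_slice 0 [set: 'rV[M]_0] 1 r 1 rp (@setT_definable 0); apply.
  by apply: (@has_class_point _ _ 0) => v; split=> // _; apply/rowP => -[].
by apply/seteqP; split=> // w _; split=> //; exact: trunc_lt.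
Qed.

(** Induction on the dimension by [basic_scons]: a graph has the class of its projection, and
    otherwise each residue class contributes the class of a base times the line. *)
Lemma basic_class n l : exists f,
  has_class [set v : 'rV[M]_n | basic l (env v)] (zhorner line_class f).
Proof.
elim: n l => [|n IH] l.
  case: (pselect (basic l (env (0 : 'rV[M]_0)))) => h; [exists 1|exists 0].
    rewrite zhorner1; apply: (@has_class_point _ _ 0) => v.
    by have -> : v = 0 by apply/rowP => -[].
  rewrite raddf0; apply: has_class_set0 => v.
  by have -> : v = 0 by apply/rowP => -[].
have [[a [t [l' [a0 l'P lP]]]]|[L [l_ lP]]] := basic_scons p_prime l.
  have [f hf] := IH l'; exists f; apply: has_class_iso hf.
  have lE w : basic l (env w) <-> basic l' (env (vtail w)) /\
      a * (w 0 0 : Zp) + (eval (env (vtail w)) t : Zp) = 0.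
    by rewrite -{1}(vconsK w) env_vcons.
  (* The solution of the equation over v. It need not be a term in v, since the forward map is the
     projection. *)
  pose y (v : 'rV[M]_n) : Zp := xget 0 (fun y : Zp => a * y + (eval (env v) t : Zp) = 0).
  have yP v : basic l' (env v) -> a * y v + (eval (env v) t : Zp) = 0.
    move=> /l'P[z hz]; rewrite /y; case: xgetP => [//|/(_ (- z))]; case.
    by rewrite hz; ring.
  apply: (@tmap_iso _ _ _ _ _ _ (fun w => vtail w) (fun v => vcons (y v : M) v)).
  - exact: definable_basic.
  - exact: tmap_vtail (@tmap_id _ _ _).
  - move=> w /lE[h e]; split=> //; rewrite -[RHS]vconsK; congr vcons.
    apply: (padic_mulI p_prime a0).
    by apply: (addIr (eval (env (vtail w)) t : Zp)); rewrite yP.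
  - by move=> v h; rewrite vtailK; split=> //; apply/lE; rewrite vcons0 vtailK yP.
have /choice[f hf] r := IH (l_ r).
exists (\sum_(r < p ^ L) f r * 'X); rewrite raddf_sum.
rewrite (_ : [set _ | _] =
  [set w | basic l (env w) /\ (trunc L (w 0 0 : Zp)%R < p ^ L)%N]); last first.
  apply/seteqP; split=> w /= => [h|[]//].
  by split; [exact: h|exact: trunc_lt].
apply: (@has_class_sum n.+1 [set w | basic l (env w)] (fun w => trunc L (w 0 0 : Zp))
  (fun r => zhorner line_class (f r * 'X)) (p ^ L)) => r rL.
have -> : [set w | basic l (env w) /\ trunc L (w 0 0 : Zp) = r] =
   [set w : 'rV[M]_n.+1 | [set v | basic (l_ r) (env v)] (vtail w) /\
     trunc L (w 0 0 : Zp) = r].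
  have lE w : basic l (env w) <-> basic (l_ (trunc L (w 0 0 : Zp))) (env (vtail w)).
    by rewrite -{1}(vconsK w) env_vcons; exact: lP.
  by apply/seteqP; split=> w /= -[h e]; split=> //; move: h; rewrite lE e.
split.
  apply: dand (definable_trunc n rL).
  exact: dsub (definable_basic n (l_ r)) (tmap_vtail (@tmap_id _ _ _)).
rewrite zhornerMX mulrC; apply: has_class_slice => //; exact: definable_basic.
Qed.

Theorem definable_class n (A : set 'rV[M]_n) : definable A ->
  exists f, has_class A (zhorner line_class f).
Proof.
move=> dA; suff [] : definable A /\ exists f, has_class A (zhorner line_class f) by [].
move: A dA; apply: (definable_ind p_prime).
- by move=> l; split; [exact: definable_basic|exact: basic_class].
- move=> A B AB [dA [f hf]] [dB [g hg]]; split; first exact: dor.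
  by exists (f + g); rewrite raddfD; exact: has_classU.
move=> A B BA [dA [f hf]] [dB [g hg]].
have dAB : definable (A `\` B).
  apply: dand dA _; case: dB => phi hphi; exists (Neg phi) => v /=.
  by rewrite -hphi.
(* The class of the difference is found by subtraction in K0, from A as the disjoint union of B and
   the difference. *)
split=> //; have [u hu] := has_class_ex dAB; exists (f - g).
rewrite raddfB (_ : _ - _ = u) //.
apply/eqP; rewrite subr_eq addrC; apply/eqP.
apply: (has_class_fun hf); rewrite (_ : A = B `|` (A `\` B)).
  by apply: has_classU => //; apply/seteqP; split=> // v [Bv []].
by apply/esym/setDUK.
Qed.

End Generation.

(** * The isomorphism *)

Local Open Scope quotient_scope.

Section VolumeMorphism.
Variables (p : nat) (T : comNzRingType) (X : T).
Hypotheses (p_prime : prime p) (XE : X *+ p = X).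
Local Notation Zp := (padic_int p).
Local Notation M := (right_regular Zp).
Local Open Scope classical_set_scope.

Definition class_vol (a : defclass M) : T := vol X (points (repr a)).

Lemma class_volE (A : defset M) : class_vol (class A) = vol X (points A).
Proof. by apply: vol_iso => //; apply/classP; rewrite /class reprK. Qed.

(** Sums with the empty set isolate the two tagged copies, which are disjoint and isomorphic to the
    two sets. *)
Lemma vol_setsum n m (A : set 'rV[M]_n) (B : set 'rV[M]_m) :
  definable A -> definable B -> vol X (setsum A B) = vol X A + vol X B.
Proof.
move=> dA dB.
have d0 k : definable (set0 : set 'rV[M]_k) by exact: dcst.
have ti := @tmap_id _ M (n + m + 1).
rewrite (_ : setsum A B = setsum A set0 `|` setsum set0 B); last first.
  apply/seteqP; split=> w; first by move=> [h|h]; [left; left|right; right].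
  by move=> [[h|[? []]]|[[? []]|h]]; [left|right].
rewrite volU //; do ?exact: setsum_definable; last first.
  apply/seteqP; split=> // w [[[a _ <-]|[? []]] [[? []]|[b _ /eq_row_mx[_]]]].
  by move=> /rowP/(_ 0)/eqP; rewrite !mxE oner_eq0.
congr (_ + _); apply: vol_iso => //.
  apply: (@tmap_iso _ _ _ _ _ _ (fun w => lsubmx (lsubmx w))
                              (fun a => row_mx (row_mx a 0) 0)).
  - exact: setsum_definable.
  - exact: tmap_l (tmap_l ti).
  - by move=> w [[a Aa <-]|[? []]]; rewrite !row_mxKl.
  - by move=> a Aa; rewrite !row_mxKl; split=> //; left; exists a.
apply: (@tmap_iso _ _ _ _ _ _ (fun w => rsubmx (lsubmx w))
                            (fun b => row_mx (row_mx 0 b) (const_mx ((1 : Zp) : M)))).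
- exact: setsum_definable.
- exact: tmap_r (tmap_l ti).
- by move=> w [[? []]|[b Bb <-]]; rewrite row_mxKl row_mxKr.
- by move=> b Bb; rewrite row_mxKl row_mxKr; split=> //; right; exists b.
Qed.

Lemma class_vol_nmod_morphism : nmod_morphism class_vol.
Proof.
split; first by rewrite -class0 class_volE; apply: (vol_set0 p_prime XE) => w [].
elim/defclassW => A; elim/defclassW => B.
rewrite -[class A + class B]/(class_add _ _) class_addE !class_volE.
by apply: vol_setsum; exact: points_definable.
Qed.

Lemma class_vol_monoid_morphism : monoid_morphism class_vol.
Proof.
split; first by rewrite -class1 class_volE; apply: (@vol_point _ _ _ p_prime XE _ _ 0).
elim/defclassW => A; elim/defclassW => B.
rewrite -classM !class_volE.
by apply: volX => //; exact: points_definable.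
Qed.

HB.instance Definition _ :=
  GRing.isNmodMorphism.Build (defclass M) T class_vol class_vol_nmod_morphism.
HB.instance Definition _ :=
  GRing.isMonoidMorphism.Build (defclass M) T class_vol class_vol_monoid_morphism.

(** The volume is a semiring morphism on classes, so it extends to K0 by the universal property. *)
Lemma K0_volume : exists g : {rmorphism K0 Zp -> T}, g (line_class p) = X.
Proof.
have [g gE _] := groth_universal (class_vol : {rmorphism defclass M -> T}).
exists g; rewrite /line_class gE [LHS]class_volE.
by rewrite vol_setT // expr1.
Qed.

End VolumeMorphism.

Lemma zhorner_morph (S S' : comPzRingType) (x : S) (g : {rmorphism S -> S'}) f :
  g (zhorner x f) = zhorner (g x) f.
Proof.
by rewrite /zhorner rmorph_sum; apply: eq_bigr => i _; rewrite raddfMz /= rmorphXn.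
Qed.

(** A polynomial is its own value at the indeterminate, and the projection commutes with
    evaluation. *)
Lemma zhorner_pi p (f : {poly int}) :
  zhorner (\pi_(ZX_mod_pred1X p) 'X) f = \pi_(ZX_mod_pred1X p) f.
Proof.
have {2}-> : f = zhorner 'X f.
  rewrite -{1}[f]coefK poly_def; apply: eq_bigr => i _.
  by rewrite -scaler_int intz.
symmetry.
exact: (zhorner_morph 'X (\pi_(ZX_mod_pred1X p) : {rmorphism {poly int} -> ZX_mod_pred1X p}) f).
Qed.

Lemma pi_eq0 p (f : {poly int}) :
  \pi_(ZX_mod_pred1X p) f = 0 <-> ideal_pred1X p f.
Proof.
have e := Quotient.idealrBE (ideal_pred1X p : idealr {poly int}) f 0; rewrite subr0 in e.
have -> : ideal_pred1X p f = (\pi_(ZX_mod_pred1X p) f == \pi_(ZX_mod_pred1X p) 0).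
  exact: e.
by rewrite rmorph0; split=> /eqP.
Qed.

Lemma zhorner_ideal (S : comPzRingType) (x : S) p f :
  x *+ p = x -> ideal_pred1X p f -> zhorner x f = 0.
Proof.
move=> xE /asboolP[r ->]; rewrite mulrA zhornerMX mulrBr mulr1 mulr_natr.
by rewrite raddfB raddfMn mulrBl mulrnAl -mulrnAr xE subrr.
Qed.

Lemma K0_generated (p : nat) (p_prime : prime p) (u : K0 (padic_int p)) :
  exists f, u = zhorner (line_class p) f.
Proof.
elim/grothW: u => -[a b]; rewrite gdiffE /=.
have gen c : exists f, groth_inj c = zhorner (line_class p) f.
  elim/defclassW: c => A; have [f hf] := definable_class p_prime (points_definable A).
  by exists f; apply: has_class_fun hf; exact: has_class_defset.
have [f ->] := gen a; have [g ->] := gen b.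
by exists (f - g); rewrite raddfB.
Qed.

(** The volume g sends f(x) to the class of f, hence is surjective. Every element of K0 is some
    f(x); if g kills it, f lies in the ideal, and f(x) = 0 because p x = x. *)
Theorem corollary6p2p3 (p : nat) (p_prime : prime p) :
  exists f : {rmorphism K0 (padic_int p) -> ZX_mod_pred1X p}, bijective f.
Proof.
pose X : ZX_mod_pred1X p := \pi_(ZX_mod_pred1X p) 'X.
have XE : X *+ p = X.
  have e : \pi_(ZX_mod_pred1X p) ('X *+ p - 'X) = X *+ p - X by rewrite raddfB raddfMn.
  apply/eqP; rewrite -subr_eq0 -e; apply/eqP/pi_eq0/asboolP; exists 1.
  by rewrite mul1r mulrBl mul1r mulr_natl.
have [g gx] := K0_volume p_prime XE; exists g.
have gE f : g (zhorner (line_class p) f) = \pi_(ZX_mod_pred1X p) f.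
  by rewrite zhorner_morph gx zhorner_pi.
have g_inj : injective g.
  move=> u v guv; apply/eqP; rewrite -subr_eq0.
  have [f e] := K0_generated p_prime (u - v); rewrite e.
  apply/eqP/(@zhorner_ideal _ _ p); first exact: line_class_mulrn.
  have : g (u - v) = 0 by rewrite raddfB /= guv subrr.
  by rewrite e gE => /pi_eq0.
have /choice[k gk] t : exists u, g u = t.
  by exists (zhorner (line_class p) (repr t)); rewrite gE reprK.
by exists k => // u; apply: g_inj; rewrite gk.
Qed.
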